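(* There exist an absolute constant $\kappa>0$ and a randomised algorithm for Learner in the Facility location game (given $N,T,C,D$ in advance) such that for all integers $N,T\ge 2$, all reals $C,D\ge 0$, every sequence of Nature's selections $(c^t,d^t)\in[0,C]^N\times[0,D]^N$, $t=1,\dots,T$, and every non-empty set $X^*\subseteq\{1,\dots,N\}$, the sets $X^1,\dots,X^T$ chosen by the algorithm satisfy $$\mathbb{E}\left(\sum_{t=1}^{T}\ell_{c^t,d^t}(X^t)\right)\le\kappa\left(\ln(T)\sum_{t=1}^{T}\ell_{c^t,d^t}(X^* )+|X^*|\,(C+D)\,\ln(T)\sqrt{\ln(N)\,T}\right),$$ and the algorithm runs in time at most $\kappa\,N\ln(N)\ln(T)$ per trial.
   Context: For $c\in[0,C]^N$ (opening costs), $d\in[0,D]^N$ (connection costs) and non-empty $X\subseteq\{1,\dots,N\}$, put $\ell_{c,d}(X)=\sum_{i\in X}c_i+\min_{i\in X}d_i$. The Facility location game runs over trials $t=1,\dots,T$. On trial $t$: (1) Nature selects $c^t\in[0,C]^N$ and $d^t\in[0,D]^N$ without revealing them; (2) Learner chooses, possibly at random, a non-empty set $X^t\subseteq\{1,\dots,N\}$, based only on $(c^s,d^s)_{s<t}$ and its internal randomness; (3) $c^t,d^t$ are revealed to Learner; (4) Learner incurs loss $\ell_{c^t,d^t}(X^t)$. Nature's sequence is an arbitrary fixed sequence and the expectation is over Learner's internal randomisation. Time is counted in elementary operations on real numbers (arithmetic, comparisons, exponentials, powers, drawing a uniform random number in $[0,1]$). *)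

(* Defs.v *)
From HB Require Import structures.
From mathcomp Require Import all_boot all_order all_algebra.
From mathcomp Require Import all_classical all_reals all_analysis.

Set Implicit Arguments.
Unset Strict Implicit.
Unset Printing Implicit Defensive.

Import Order.TTheory GRing.Theory Num.Theory.
Import numFieldNormedType.Exports.

Local Open Scope classical_set_scope.
Local Open Scope ring_scope.

Section Loss.
Variables (R : realType) (N : nat).

(* The value 0 for the empty set is a dummy: the minimum is only meant for a
   non-empty X. *)
Definition min_over (X : {set 'I_N}) (f : 'I_N -> R) : R :=
  if [pick i in X] is Some i0 then \big[Num.min/f i0]_(i in X) f i else 0.

Definition loss (c d : 'I_N -> R) (X : {set 'I_N}) : R :=
  \sum_(i in X) c i + min_over X d.

End Loss.

(* A real random-access machine, presented as a structured imperative language.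
   A program is a finite piece of syntax that mentions neither N, T, C, D nor
   the field of reals: one program has to serve all instances.  Indices are
   held in separate natural-number registers.  They have no multiplication, and
   a real can never be converted to an index. *)

Inductive iexp : Type :=
| IConst of nat
| IVar of nat
| IAdd of iexp & iexp
| ISub of iexp & iexp.

(* Real memory is a family of unbounded arrays: [RGet a e] reads the cell of
   array [a] whose index is the value of [e].  The only real literals are
   natural numbers, so no information can be hidden in a constant. *)
Inductive rexp : Type :=
| RNat of nat
| RGet of nat & iexp
| RAdd of rexp & rexp
| RSub of rexp & rexp
| RMul of rexp & rexp
| RDiv of rexp & rexp
| RExp of rexp
| RPow of rexp & rexp.

Inductive bexp : Type :=
| BRlt of rexp & rexp
| BIlt of iexp & iexp
| BNot of bexp
| BAnd of bexp & bexp.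

(* [Draw a e] stores a fresh uniform random number in cell [e] of array [a]. *)
Inductive com : Type :=
| Skip
| Seq of com & com
| ISet of nat & iexp
| RSet of nat & iexp & rexp
| Draw of nat & iexp
| If of bexp & com & com
| While of bexp & com.

(* Every node of an expression, memory reads and constants included, costs 1. *)
Fixpoint icost (e : iexp) : nat :=
  match e with
  | IConst _ | IVar _ => 1
  | IAdd e1 e2 | ISub e1 e2 => (icost e1 + icost e2).+1%N
  end.

Fixpoint rcost (e : rexp) : nat :=
  match e with
  | RNat _ => 1
  | RGet _ i => (icost i).+1
  | RAdd e1 e2 | RSub e1 e2 | RMul e1 e2 | RDiv e1 e2 | RPow e1 e2 =>
      (rcost e1 + rcost e2).+1%N
  | RExp e1 => (rcost e1).+1
  end.

Fixpoint bcost (b : bexp) : nat :=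
  match b with
  | BRlt e1 e2 => (rcost e1 + rcost e2).+1%N
  | BIlt e1 e2 => (icost e1 + icost e2).+1%N
  | BNot b1 => (bcost b1).+1
  | BAnd b1 b2 => (bcost b1 + bcost b2).+1%N
  end.

Section Semantics.
Variable R : realType.

(* [ndraws] counts the random numbers consumed so far; it is not readable by
   programs and serves to make every draw use a new entry of the tape. *)
Record state := State {
  ivars : nat -> nat;
  cells : nat -> nat -> R;
  ndraws : nat }.

Definition set_ivar (s : state) (x n : nat) : state :=
  State (fun y => if y == x then n else ivars s y) (cells s) (ndraws s).

Definition set_cell (s : state) (a i : nat) (r : R) : state :=
  State (ivars s)
    (fun b j => if (b == a) && (j == i) then r else cells s b j) (ndraws s).

Definition next_draw (s : state) : state :=
  State (ivars s) (cells s) (ndraws s).+1.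

Fixpoint ieval (s : state) (e : iexp) : nat :=
  match e with
  | IConst n => n
  | IVar x => ivars s x
  | IAdd e1 e2 => (ieval s e1 + ieval s e2)%N
  | ISub e1 e2 => (ieval s e1 - ieval s e2)%N
  end.

(* Division and real powers are the library's total functions: x / 0 = 0,
   0 `^ 0 = 1, 0 `^ y = 0 for y <> 0, and x `^ y = 1 for x < 0. *)
Fixpoint reval (s : state) (e : rexp) : R :=
  match e with
  | RNat n => n%:R
  | RGet a i => cells s a (ieval s i)
  | RAdd e1 e2 => reval s e1 + reval s e2
  | RSub e1 e2 => reval s e1 - reval s e2
  | RMul e1 e2 => reval s e1 * reval s e2
  | RDiv e1 e2 => reval s e1 / reval s e2
  | RExp e1 => expR (reval s e1)
  | RPow e1 e2 => powR (reval s e1) (reval s e2)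
  end.

Fixpoint beval (s : state) (b : bexp) : bool :=
  match b with
  | BRlt e1 e2 => reval s e1 < reval s e2
  | BIlt e1 e2 => (ieval s e1 < ieval s e2)%N
  | BNot b1 => ~~ beval s b1
  | BAnd b1 b2 => beval s b1 && beval s b2
  end.

(* [exec u p s s' n]: with random tape [u], program [p] started in [s] halts in
   [s'] after [n] elementary operations. *)
Inductive exec (u : nat -> R) : com -> state -> state -> nat -> Prop :=
| exec_skip s : exec u Skip s s 1
| exec_seq p q s s1 s2 m n :
    exec u p s s1 m -> exec u q s1 s2 n -> exec u (Seq p q) s s2 (m + n)%N
| exec_iset x e s :
    exec u (ISet x e) s (set_ivar s x (ieval s e)) (icost e).+1
| exec_rset a i e s :
    exec u (RSet a i e) s (set_cell s a (ieval s i) (reval s e))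
      (icost i + rcost e).+1%N
| exec_draw a i s :
    exec u (Draw a i) s
      (next_draw (set_cell s a (ieval s i) (u (ndraws s)))) (icost i).+1
| exec_if_true b p q s s1 n :
    beval s b -> exec u p s s1 n -> exec u (If b p q) s s1 (bcost b + n).+1%N
| exec_if_false b p q s s1 n :
    ~~ beval s b -> exec u q s s1 n -> exec u (If b p q) s s1 (bcost b + n).+1%N
| exec_while_true b p s s1 s2 m n :
    beval s b -> exec u p s s1 m -> exec u (While b p) s1 s2 n ->
    exec u (While b p) s s2 (bcost b + m + n).+1%N
| exec_while_false b p s :
    ~~ beval s b -> exec u (While b p) s s (bcost b).+1.

(* Memory layout of the interface with the environment: registers 0 and 1 hold
   N and T; cells 0 to 3 of array 0 hold N, T, C, D as reals; arrays 1 and 2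
   receive the revealed opening and connection costs; array 3 holds the
   selected set.  Everything else is initially 0. *)
Definition initial_state (N T : nat) (C D : R) : state :=
  State (nth 0%N [:: N; T])
    (fun a => if a == 0%N then nth 0 [:: N%:R; T%:R; C; D] else fun=> 0) 0.

Definition selected (N : nat) (s : state) : {set 'I_N} :=
  [set i : 'I_N | cells s 3 i != 0]%SET.

Definition overwrite (N : nat) (f : 'I_N -> R) (g : nat -> R) : nat -> R :=
  fun i => if insub i is Some j then f j else g i.

Definition reveal (N : nat) (c d : 'I_N -> R) (s : state) : state :=
  State (ivars s)
    (fun a => if a == 1%N then overwrite c (cells s 1)
              else if a == 2%N then overwrite d (cells s 2)
              else cells s a)
    (ndraws s).

End Semantics.

(* On each trial [choose] runs before the costs are revealed and [update]
   after.  There is no separate initialisation phase: preprocessing has to be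
   performed, and paid for, within the trials. *)
Record algorithm := Algorithm { choose : com; update : com }.

(* [plays A C D c d u X time]: on random tape [u] and against the costs
   [c], [d], algorithm [A] selects [X t] on trial [t] and spends [time t]
   operations on that trial.  The choice on trial [t] is made in a state that
   has been exposed only to the costs of the earlier trials. *)
Definition plays (R : realType) (A : algorithm) (N T : nat) (C D : R)
    (c d : 'I_T -> 'I_N -> R) (u : nat -> R)
    (X : 'I_T -> {set 'I_N}) (time : 'I_T -> nat) : Prop :=
  exists s : nat -> state R,
    s 0%N = initial_state N T C D /\
    forall t : 'I_T, exists (s' : state R) (m n : nat),
      [/\ exec u (choose A) (s t) s' m,
          X t = selected N s',
          exec u (update A) (reveal (c t) (d t) s') (s t.+1) n
        & time t = (m + n)%N].

Section Randomness.
Context {disp : measure_display} {Omega : measurableType disp} {R : realType}.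
Variable P : probability Omega R.

Definition mutually_independent (U : nat -> {RV P >-> R}) : Prop :=
  forall (J : seq nat) (B : nat -> set R),
    uniq J -> (forall j, measurable (B j)) ->
    P (\bigcap_(j in [set` J]) (U j @^-1` B j)) =
    (\prod_(j <- J) P (U j @^-1` B j))%E.

Definition uniform01 (Y : {RV P >-> R}) : Prop :=
  forall B : set R, measurable B ->
    distribution P Y B = uniform_prob (@ltr01 R) B.

Definition iid_uniform01 (U : nat -> {RV P >-> R}) : Prop :=
  mutually_independent U /\ forall j, uniform01 (U j).

End Randomness.

(* Main.v *)
Require Import Defs.
From HB Require Import structures.
From mathcomp Require Import all_boot all_order all_algebra.
From mathcomp Require Import all_classical all_reals all_analysis.
From mathcomp Require Import measurable_realfun ring lra zify.

Set Implicit Arguments.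
Unset Strict Implicit.
Unset Printing Implicit Defensive.

Import Order.TTheory GRing.Theory Num.Theory.
Import numFieldNormedType.Exports.

Local Open Scope classical_set_scope.
Local Open Scope ring_scope.

(* Put W = C + D and relax the game to non-negative weight vectors y.  A set
   that contains each site i independently with probability 1 - T^(-y_i) misses
   a set B with probability T^(-y(B)), which is at most 1 - (1 - 1/T) y(B) when
   y(B) <= 1.  So its expected opening cost is at most ln T times sum_i c_i y_i,
   and, decomposing the distance saved below a radius r into layers, its
   expected connection cost is at most r - sum_i y_i (r - d_i)_+ + O(W / T),
   provided the sites at distance < r have mass at most 1 and r is within W / T
   of a radius of mass at least 1 (or of W).  Bisection finds such an r by
   log T linear scans; no sorting is needed.

   For each fixed r the bound is linear in y, and at the indicator vector of a
   set X it is at most the loss of X, because r - (r - d_i)_+ <= d_i.  The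
   weights are therefore updated by unnormalised exponentiated gradient,
   y_i <- y_i exp (eta ((r - d_i)_+ - c_i)).  The potential sum_i y_i gives a
   regret bound whose second-order terms are eta W sum_i c_i y_i, absorbed into
   the loss itself, and eta W^2, because sum_i y_i (r - d_i)_+ <= W.  The rate
   is eta = sqrt (L / T) / W with L = N (N^(1/N) - 1), which lies between ln N
   and 2 ln N and needs no logarithm.  If T < 16 L the learner just plays one
   fixed site, and the trivial bound W T suffices. *)

(** * Real inequalities *)

Section RealInequalities.
Variable R : realType.
Implicit Types x z : R.

(* From [1 - z / 2 <= expR (- z / 2)] by squaring and inverting. *)
Lemma expR_le_quadratic z : z <= 4^-1 -> expR z <= 1 + z + z ^+ 2.
Proof.
move=> z4; have h := expR_ge1Dx (- (z / 2)).
have p0 : 0 < 1 - z / 2 by lra.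
have : (1 - z / 2) ^+ 2 <= expR (- z).
  have -> : expR (- z) = expR (- (z / 2)) ^+ 2.
    by rewrite expr2 -expRD; congr expR; lra.
  by rewrite ler_sqr ?nnegrE ?expR_ge0//; lra.
rewrite expRN => h2.
have e0 := expR_gt0 z.
have h3 : expR z * (1 - z / 2) ^+ 2 <= 1.
  by rewrite -ler_pdivlMl// mulr1.
(* Here [z <= 1 / 4] keeps [1 - 3 z], hence the correction term, non-negative. *)
have h4 : 1 <= (1 + z + z ^+ 2) * (1 - z / 2) ^+ 2.
  have -> : (1 + z + z ^+ 2) * (1 - z / 2) ^+ 2 =
    1 + z ^+ 2 / 4 * (1 - 3 * z + z ^+ 2) by field.
  rewrite lerDl mulr_ge0//; last by have := sqr_ge0 z; lra.
  by rewrite mulr_ge0 ?sqr_ge0// invr_ge0.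
by rewrite -(ler_pM2r (x := (1 - z / 2) ^+ 2)) ?exprn_gt0//; exact: le_trans h4.
Qed.

(** Convexity of the exponential between [ln x] and 0. At [x = 1 / T] it bounds from below the
    probability of hitting a set of mass [z]. *)
Lemma powR_le_chord x z : 0 < x -> 0 <= z <= 1 ->
  x `^ z <= 1 - z + z * x.
Proof.
move=> x0 /andP[z0 z1].
have := @convex_expR R (Itv01 z0 z1) (ln x) 0.
rewrite !convRE/= /unstable.onem mulr0 addr0 expR0 lnK ?posrE// mulr1.
by rewrite /powR gt_eqF// addrC.
Qed.

Lemma one_sub_powRN_le (T z : R) : 0 < T -> 1 - T `^ (- z) <= ln T * z.
Proof.
move=> T0; rewrite /powR gt_eqF//.
have := expR_ge1Dx (- z * ln T); lra.
Qed.

Lemma ln2_ge_half : 2^-1 <= ln (2 : R).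
Proof.
have := @expR_ge1Dx R (- ln 2); rewrite expRN lnK ?posrE//.
by lra.
Qed.

Lemma ln_nat_ge_half (n : nat) : (2 <= n)%N -> 2^-1 <= ln (n%:R : R).
Proof.
move=> n2; apply: le_trans ln2_ge_half _.
by rewrite ler_ln ?posrE ?ltr0n ?ler_nat// (leq_trans _ n2).
Qed.

Definition approx_ln x : R := x * (x `^ (1 / x) - 1).

(** With [a = ln x / x] the middle term is [x (e^a - 1)], and [a <= e^a - 1 <= 2 a] for
    [0 <= a <= 1 / 2]; the upper bound follows from [e^a <= 1 / (1 - a)]. *)
Lemma approx_ln_bounds x : 2 <= x -> ln x <= approx_ln x <= 2 * ln x.
Proof.
move=> x2; have x0 : 0 < x by lra.
rewrite /approx_ln /powR gt_eqF//.
have l0 : 0 <= ln x by rewrite ln_ge0//; lra.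
set a := 1 / x * ln x.
have al : x * a = ln x by rewrite /a mulrA mulrCA mulfV ?gt_eqF// !mulr1 mul1r.
have a0 : 0 <= a by rewrite /a mulr_ge0// divr_ge0//; lra.
(* This amounts to [2 ln x <= x]: [2 ln x = 4 ln (sqrt x) <= 4 (sqrt x - 1)], and
   [(sqrt x - 2)^2 >= 0]. *)
have a2 : a <= 2^-1.
  rewrite -(ler_pM2l x0) al.
  have s0 : 0 < Num.sqrt x by rewrite sqrtr_gt0.
  have xs : x = Num.sqrt x ^+ 2 by rewrite sqr_sqrtr// ltW.
  have : ln (1 + (Num.sqrt x - 1)) <= Num.sqrt x - 1 by apply: le_ln1Dx; lra.
  rewrite addrC subrK.
  have -> : ln x = ln (Num.sqrt x) *+ 2 by rewrite -lnXn// -xs.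
  rewrite -mulr_natr.
  have := sqr_ge0 (Num.sqrt x - 2); rewrite sqrrB -xs => s2 ls; lra.
have ea := expR_ge1Dx a.
have ena := expR_ge1Dx (- a).
rewrite expRN in ena.
have e0 := expR_gt0 a.
have : expR a * (1 - a) <= 1.
  by rewrite -ler_pdivlMl// mulr1.
move=> h; rewrite -al; apply/andP; split.
  by rewrite ler_pM2l//; lra.
by rewrite mulrCA ler_pM2l//; nra.
Qed.

End RealInequalities.

(** * Layers, and the expected loss of a random set *)

Section Sets.
Local Close Scope classical_set_scope.
Local Open Scope set_scope.
Local Open Scope ring_scope.
Variables (R : realType) (I : finType).
Implicit Types (a c d y : I -> R) (S X : {set I}).

Definition miss X S : R := ([disjoint X & S])%:R.

(** The empty set gets the value 0, as befits a set that saves no distance. *)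
Definition max_over X a : R := \big[Num.max/0]_(i in X) a i.

Lemma max_over_ge X a i : i \in X -> a i <= max_over X a.
Proof. by move=> iX; apply: le_bigmax_cond. Qed.

Lemma max_over_le X a r : 0 <= r -> (forall i, i \in X -> a i <= r) ->
  max_over X a <= r.
Proof. by move=> r0 h; apply: bigmax_le. Qed.

Lemma max_over_ge0 X a : (forall i, 0 <= a i) -> 0 <= max_over X a.
Proof. by move=> a0; apply: bigmax_ge_id. Qed.

(* Peel off the least positive value of [a] as long as there is one. *)
Lemma layer_cake a : (forall i, 0 <= a i) ->
  exists s : seq (R * {set I}),
    (forall u, u \in s -> 0 <= u.1 /\ forall i, i \in u.2 -> 0 < a i) /\
    forall X, max_over X a = \sum_(u <- s) u.1 * (1 - miss X u.2).
Proof.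
have [n] := ubnP #|[set i | 0 < a i]|.
elim: n a => // n IH a an a0.
set B := [set i | 0 < a i] in an.
have [B0|[j jB]] := set_0Vmem B.
  exists [::]; split => // X; rewrite big_nil; apply/eqP.
  rewrite eq_le max_over_ge0// andbT; apply: max_over_le => // i _.
  by move/setP/(_ i): B0; rewrite !inE leNgt => ->.
have [k kB kmin] : exists2 k, k \in B & forall i, i \in B -> a k <= a i.
  by case: (Order.TotalTheory.arg_minP a jB) => k kB kmin; exists k.
have ak : 0 < a k by move: kB; rewrite inE.
pose a' i := if i \in B then a i - a k else 0.
have a'0 i : 0 <= a' i by rewrite /a'; case: ifP => // /kmin; rewrite subr_ge0.
have aB i : i \notin B -> a i = 0.
  by rewrite inE -leNgt => h; apply/eqP; rewrite eq_le h a0.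
have [] := IH a' _ a'0.
  rewrite ltnS in an; apply: leq_trans an; apply: proper_card.
  apply/properP; split; last by exists k => //; rewrite inE /a' kB subrr ltxx.
  by apply/fintype.subsetP => i; rewrite inE /a'; case: ifP => //; rewrite ltxx.
move=> s [sP sE]; exists ((a k, B) :: s); split.
  move=> u; rewrite inE => /predU1P[->/=|us].
    by split; [exact: ltW|move=> i; rewrite inE].
  have [u0 uP] := sP _ us; split => // i /uP.
  by rewrite /a'; case: ifP; rewrite ?ltxx// inE.
move=> X; rewrite big_cons -sE /= /miss.
have [XB|/pred0Pn[i /andP[/= iX iB]]] := boolP [disjoint X & B].
  rewrite subrr mulr0 add0r; apply: eq_bigr => i iX.
  have iB : i \notin B by rewrite (disjointFr XB).
  by rewrite /a' (negPf iB) aB.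
rewrite subr0 mulr1; apply/eqP; rewrite eq_le; apply/andP; split.
  apply: max_over_le => [|l lX]; first by rewrite addr_ge0 ?max_over_ge0// ltW.
  have [lB|lB] := boolP (l \in B).
    have := max_over_ge a' lX; rewrite /a' lB; lra.
  by rewrite aB// addr_ge0 ?max_over_ge0// ltW.
have mk : a k <= max_over X a by apply: le_trans (kmin _ iB) (max_over_ge _ iX).
rewrite -lerBrDl; apply: max_over_le => [|l lX]; first by rewrite subr_ge0.
rewrite /a'; case: ifP => lB; last by rewrite subr_ge0.
by rewrite lerD2r max_over_ge.
Qed.

End Sets.
Arguments miss {R I}.

(** * Loss of a set that contains each site independently *)

Section Loss.
Local Close Scope classical_set_scope.
Local Open Scope set_scope.
Local Open Scope ring_scope.
Variables (R : realType) (N : nat).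
Implicit Types (X Y S : {set 'I_N}) (c d y : 'I_N -> R).

Lemma min_over_le X d i : i \in X -> min_over X d <= d i.
Proof.
rewrite /min_over => iX; case: pickP => [i0 _|/(_ i)]; last by rewrite iX.
exact: bigmin_le_cond.
Qed.

Lemma min_over_ge X d z : X != finset.set0 -> (forall i, i \in X -> z <= d i) ->
  z <= min_over X d.
Proof.
move=> /set0Pn[i iX] h.
rewrite /min_over; case: pickP => [i0 i0X|/(_ i)]; last by rewrite iX.
by apply: le_bigmin => //; apply: h.
Qed.

Lemma loss_ge0 c d X : (forall i, 0 <= c i) -> (forall i, 0 <= d i) ->
  0 <= loss c d X.
Proof.
move=> c0 d0; rewrite addr_ge0 ?sumr_ge0// /min_over.
by case: pickP => // i0 _; apply: le_bigmin.
Qed.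

(** The independent draws may all fail, while the game requires a non-empty set. *)
Definition fallback (i0 : 'I_N) X := if X == finset.set0 then [set i0] else X.

Lemma fallback_neq0 i0 X : fallback i0 X != finset.set0.
Proof.
rewrite /fallback; case: ifPn => // _.
by apply/set0Pn; exists i0; rewrite inE.
Qed.

Variables (C D : R) (c d : 'I_N -> R).
Hypothesis c0C : forall i, 0 <= c i <= C.
Hypothesis d0D : forall i, 0 <= d i <= D.
Variable i0 : 'I_N.

Let c0 i : 0 <= c i. Proof. by have /andP[] := c0C i. Qed.
Let d0 i : 0 <= d i. Proof. by have /andP[] := d0D i. Qed.

Lemma loss_set1_le : loss c d [set i0] <= C + D.
Proof.
rewrite /loss big_set1 lerD//; first by have /andP[] := c0C i0.
apply: (le_trans (min_over_le _ (set11 i0))).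
by have /andP[] := d0D i0.
Qed.

Definition gap (r : R) (i : 'I_N) : R := Num.max 0 (r - d i).

Lemma gap_ge0 r i : 0 <= gap r i.
Proof. by rewrite le_max lexx. Qed.

(** If a site of [X] is nearer than [r], the best one has distance [r] minus the largest gap.
    Otherwise all gaps vanish, and a site within [r + w] suffices. If there is none either, the
    whole of [C + D] is charged; this cannot happen to a non-empty [X] when [r + w] equals [C + D],
    since [d i <= D], and for the empty set [r + w] then pays for the fallback. *)
Lemma loss_fallback_le X (r w : R) : 0 <= r -> 0 <= w -> r + w <= C + D ->
  loss c d (fallback i0 X) <=
  \sum_(i in X) c i + (r - max_over X (gap r)) + w +
  (if r + w == C + D then 0 else (C + D) * miss X [set i | d i <= r + w]).
Proof.
move=> r0 w0 rw; have W0 : 0 <= C + D by lra.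
set e := (if _ then _ else _).
have e0 : 0 <= e by rewrite /e; case: ifP => // _; rewrite mulr_ge0 ?ler0n.
rewrite /fallback; case: ifPn => [/eqP X0|X0].
  apply: le_trans loss_set1_le _.
  rewrite /e X0 /max_over !big_set0; case: ifP => [/eqP|]; first by lra.
  rewrite /miss finset.disjoints_subset finset.sub0set mulr1 => _; lra.
rewrite -!addrA; apply: lerD => //.
have [r1|r1] := leP (max_over X (gap r)) 0; last first.
  have [i iX iE] : exists2 i, i \in X & max_over X (gap r) <= gap r i.
    have /set0Pn[j jX] := X0.
    case: (Order.TotalTheory.arg_maxP (gap r) jX) => i iX im; exists i => //.
    by apply: max_over_le => //; apply: gap_ge0.
  have := min_over_le d iX.
  move: iE; rewrite /gap; have [|] := leP 0 (r - d i); lra.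
rewrite /e; case: ifP => [/eqP rwE|_].
  have /set0Pn[j jX] := X0.
  have := min_over_le d jX; have /andP[_] := d0D j.
  have /andP[] := c0C j; lra.
rewrite /miss; have [XB|/pred0Pn[j /andP[/= jX jB]]] := boolP [disjoint _ & _].
  have /set0Pn[j jX] := X0; rewrite /= mulr1.
  have := min_over_le d jX; have /andP[_] := d0D j.
  have /andP[] := c0C j; lra.
have := min_over_le d jX; move: jB; rewrite inE; lra.
Qed.

(* [p] is the law of a random set that contains each [i] independently with
   probability [1 - T `^ (- y i)]. *)
Variables (T : nat) (p : {set 'I_N} -> R) (y : 'I_N -> R).
Hypothesis T2 : (2 <= T)%N.
Hypothesis p0 : forall X, 0 <= p X.
Hypothesis p1 : \sum_X p X = 1.
Hypothesis pmiss : forall S,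
  \sum_X p X * miss X S = T%:R `^ (- \sum_(i in S) y i).
Hypothesis y0 : forall i, 0 <= y i.

Let T0 : 0 < T%:R :> R. Proof. by rewrite ltr0n (leq_trans _ T2). Qed.

(** By linearity: site [i] is opened with probability [1 - T^(- y i)], which is at most
    [ln T * y i]. *)
Lemma expected_opening_le :
  \sum_X p X * (\sum_(i in X) c i) <= ln T%:R * \sum_i c i * y i.
Proof.
have -> : \sum_X p X * (\sum_(i in X) c i) =
    \sum_i c i * (1 - T%:R `^ (- y i)).
  transitivity (\sum_X \sum_i c i * (p X - p X * miss X [set i])).
    apply: eq_bigr => X _; rewrite mulr_sumr big_mkcond; apply: eq_bigr => i _.
    rewrite /miss disjoint_sym disjoints1.
    by case: (i \in X) => /=; rewrite ?mulr1 ?mulr0 ?subrr ?subr0 ?mulr0// mulrC.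
  rewrite exchange_big; apply: eq_bigr => i _.
  by rewrite -mulr_sumr sumrB p1 pmiss big_set1.
rewrite mulr_sumr; apply: ler_sum => i _.
rewrite mulrCA ler_wpM2l//; exact: one_sub_powRN_le.
Qed.

(** Both sides split along the layers of [a]. A layer lies in the support of [a], so its mass [z] is
    at most 1, and it is hit with probability [1 - T^(- z) >= (1 - 1 / T) z]. *)
Lemma expected_max_over_ge (a : 'I_N -> R) : (forall i, 0 <= a i) ->
  \sum_(i | 0 < a i) y i <= 1 ->
  (1 - T%:R^-1) * (\sum_i y i * a i) <= \sum_X p X * max_over X a.
Proof.
move=> a0 ya; have [s [sP sE]] := layer_cake a0.
(* The layer decomposition of the maximum, read on singletons, recovers [a] itself. *)
have aE i : a i = \sum_(u <- s) u.1 * (i \in u.2)%:R.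
  have := sE [set i]; rewrite /max_over big_set1E max_l// => ->.
  apply: eq_bigr => u _; rewrite /miss disjoints1.
  by case: (i \in u.2); rewrite /= ?subr0 ?subrr.
have -> : \sum_i y i * a i = \sum_(u <- s) u.1 * \sum_(i in u.2) y i.
  under eq_bigr do rewrite aE mulr_sumr.
  rewrite exchange_big; apply: eq_bigr => u _.
  rewrite mulr_sumr [RHS]big_mkcond; apply: eq_bigr => i _.
  by case: ifP; rewrite ?mulr1 ?mulr0// mulrC.
have -> : \sum_X p X * max_over X a =
    \sum_(u <- s) u.1 * (1 - T%:R `^ (- \sum_(i in u.2) y i)).
  under eq_bigr do rewrite sE mulr_sumr.
  rewrite exchange_big; apply: eq_bigr => u _.
  rewrite -pmiss -[X in _ = _ * (X - _)]p1 -sumrB mulr_sumr.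
  by apply: eq_bigr => X _; ring.
rewrite mulr_sumr big_seq [leRHS]big_seq; apply: ler_sum => u us.
have [u0 ua] := sP _ us; rewrite mulrCA ler_wpM2l//.
have z0 : 0 <= \sum_(i in u.2) y i by apply: sumr_ge0.
have z1 : \sum_(i in u.2) y i <= 1.
  apply: le_trans ya; rewrite big_mkcond [leRHS]big_mkcond.
  by apply: ler_sum => i _; case: ifP => [/ua ->//|_]; case: ifP.
set z := \sum_(i in u.2) y i in z0 z1 *.
have -> : T%:R `^ (- z) = (T%:R^-1) `^ z :> R.
  by rewrite -powR_inv1 ?ltW// -powRrM mulN1r.
have := @powR_le_chord R (T%:R^-1) z.
rewrite invr_gt0 z0 z1 => /(_ T0 isT); lra.
Qed.

(** The error consists of three terms of size at most [(C + D) / T]: the width [w], the charge for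
    missing all sites within [r + w], and the loss through the factor [1 - 1 / T] on the gaps. *)
Lemma expected_loss_le (r w : R) : 0 <= r -> 0 <= w -> r + w <= C + D ->
  w <= (C + D) / T%:R ->
  \sum_(i | d i < r) y i <= 1 ->
  (r + w == C + D) || (1 <= \sum_(i | d i <= r + w) y i) ->
  \sum_X p X * loss c d (fallback i0 X) <=
  ln T%:R * (\sum_i c i * y i) + (r - \sum_i y i * gap r i)
  + 3 * (C + D) / T%:R.
Proof.
move=> r0 w0 rw wT yr yrw; have W0 : 0 <= C + D by lra.
pose e X := if r + w == C + D then 0
            else (C + D) * miss X [set i | d i <= r + w].
(* Sites of mass at least 1 are all missed with probability at most [1 / T]. *)
have eE : \sum_X p X * e X <= (C + D) / T%:R.
  rewrite /e; case: eqP yrw => [_ _|_ /= y1].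
    by rewrite big1 ?divr_ge0 ?(ltW T0)// => X _; rewrite mulr0.
  under eq_bigr do rewrite mulrCA.
  rewrite -mulr_sumr pmiss ler_wpM2l// -(powR_inv1 (ltW T0)) ler_powR//.
    by rewrite ler1n (leq_trans _ T2).
  by rewrite lerN2; under [leRHS]eq_bigl do rewrite inE.
have gap_lt i : 0 < gap r i -> d i < r.
  by rewrite lt_max ltxx /= subr_gt0.
have ga : \sum_(i | 0 < gap r i) y i <= 1.
  apply: le_trans yr; rewrite big_mkcond [leRHS]big_mkcond.
  by apply: ler_sum => i _; case: ifP => [/gap_lt ->//|_]; case: ifP.
have := expected_max_over_ge (gap_ge0 r) ga.
have yg : \sum_i y i * gap r i <= C + D.
  apply: (@le_trans _ _ (\sum_(i | d i < r) y i * (C + D))); last first.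
    by rewrite -mulr_suml ler_piMl.
  rewrite [leRHS]big_mkcond; apply: ler_sum => i _; case: ifP => dr.
    rewrite ler_wpM2l// ge_max W0 /=; have := d0 i; lra.
  by rewrite /gap max_l ?mulr0// subr_le0 leNgt dr.
have := expected_opening_le.
set O := \sum_X _; set M := \sum_X _ * max_over _ _.
set G := \sum_i _ * gap _ _ => OL ML.
have GT : G * T%:R^-1 <= (C + D) / T%:R by rewrite ler_wpM2r// invr_ge0 ltW.
suff : \sum_X p X * loss c d (fallback i0 X) <=
    O + (r - M) + w + \sum_X p X * e X by lra.
have -> : O + (r - M) + w + \sum_X p X * e X =
    \sum_X p X * (\sum_(i in X) c i + (r - max_over X (gap r)) + w + e X).
  under [RHS]eq_bigr do rewrite !mulrDr mulrN.
  by rewrite !big_split /= sumrN -!mulr_suml p1 !mul1r.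
by apply: ler_sum => X _; rewrite ler_wpM2l//; exact: loss_fallback_le.
Qed.

End Loss.

(** * Bisection and regret *)

Section Bisection.
Variables (R : realType) (I : finType) (W : R) (d y : I -> R).

(** The pair is the left end and the width of the current interval, as the program stores it. *)
Fixpoint bisect (k : nat) : R * R :=
  if k is k'.+1 then
    let w := (bisect k').2 / 2 in
    (if \sum_(i | d i <= (bisect k').1 + w) y i < 1 then (bisect k').1 + w
     else (bisect k').1, w)
  else (0, W).

Hypothesis W0 : 0 <= W.
Hypothesis d0 : forall i, 0 <= d i.
Hypothesis y0 : forall i, 0 <= y i.

Lemma bisect_width k : (bisect k).2 = W / 2 ^+ k.
Proof.
elim: k => [|k IH] /=; first by rewrite expr0 divr1.
by rewrite IH exprSr invfM mulrA.
Qed.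

(** The left end moves only to a point whose closed ball has mass below 1, and the ball of radius 0
    is empty at the start because it is open. The right end either was tested and found to have mass
    at least 1, or is still the initial [W]. *)
Lemma bisect_spec k (r := (bisect k).1) (w := (bisect k).2) :
  [/\ 0 <= r, 0 <= w, r + w <= W, \sum_(i | d i < r) y i <= 1 &
      (r + w == W) || (1 <= \sum_(i | d i <= r + w) y i)].
Proof.
rewrite {}/r {}/w; elim: k => [|k] /=.
  rewrite lexx add0r lexx eqxx W0; split => //.
  by rewrite big_pred0 ?ler01// => i; apply/negbTE; rewrite -leNgt.
case: (bisect k) => r w /= [r0 w0 rw lt1 ge1].
have w20 : 0 <= w / 2 by rewrite divr_ge0.
have ww : r + w / 2 + w / 2 = r + w by lra.
case: ltP => h; split; rewrite ?ww ?h ?orbT ?addr_ge0//.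
- apply: le_trans (ltW h); rewrite big_mkcond [leRHS]big_mkcond.
  by apply: ler_sum => i _; case: ifP => [/ltW ->//|_]; case: ifP.
- by apply: le_trans rw; rewrite -ww lerDl.
Qed.

End Bisection.

(** * Regret of unnormalised exponentiated gradient *)

Section Regret.
Local Close Scope classical_set_scope.
Local Open Scope set_scope.
Local Open Scope ring_scope.
Variables (R : realType) (I : finType).
Variables (W eta : R) (c a g : nat -> I -> R).

(** Closed form of the multiplicative updates: [x] is the cumulative gain of a site, and every
    weight starts at [1 / #|I|]. *)
Definition weight (x : R) : R := expR (eta * x) / #|I|%:R.

Hypothesis I0 : (0 < #|I|)%N.
Hypothesis eta0 : 0 < eta.
Hypothesis etaW : eta * W <= 4^-1.
Hypothesis c0W : forall t i, 0 <= c t i <= W.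
Hypothesis a0W : forall t i, 0 <= a t i <= W.
Hypothesis g0 : forall i, g 0 i = 0.
Hypothesis gS : forall t i, g t.+1 i = g t i + (a t i - c t i).
Hypothesis aW : forall t, \sum_i weight (g t i) * a t i <= W.

Let n0 : 0 < #|I|%:R :> R. Proof. by rewrite ltr0n. Qed.

Lemma weight_ge0 x : 0 <= weight x.
Proof. by rewrite divr_ge0 ?expR_ge0. Qed.

(** Expand [e^z <= 1 + z + z^2] and use [(a - c)^2 <= W a + W c] on [[0, W]]. The part with [a] is
    bounded through the weighted total of the gaps; the part with [c] is kept, to be absorbed into
    the loss. *)
Lemma total_weight_step t :
  \sum_i weight (g t.+1 i) <= \sum_i weight (g t i)
    + eta * (\sum_i weight (g t i) * (a t i - c t i))
    + eta ^+ 2 * W * (\sum_i weight (g t i) * c t i) + eta ^+ 2 * W ^+ 2.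
Proof.
have W0 : 0 <= W.
  by move: I0 => /card_gt0P[i _]; have /andP[/le_trans h /h] := c0W 0 i.
have : eta ^+ 2 * W * (\sum_i weight (g t i) * a t i) <= eta ^+ 2 * W ^+ 2.
  by rewrite [W ^+ 2]expr2 mulrA ler_wpM2l// mulr_ge0// sqr_ge0.
suff : \sum_i weight (g t.+1 i) <= \sum_i weight (g t i)
    + eta * (\sum_i weight (g t i) * (a t i - c t i))
    + eta ^+ 2 * W * (\sum_i weight (g t i) * c t i)
    + eta ^+ 2 * W * (\sum_i weight (g t i) * a t i) by lra.
rewrite !mulr_sumr -!big_split /=; apply: ler_sum => i _.
have -> : weight (g t.+1 i) = weight (g t i) * expR (eta * (a t i - c t i)).
  by rewrite /weight gS mulrDr expRD mulrAC.
have y0 := weight_ge0 (g t i).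
have /andP[cl cu] := c0W t i; have /andP[al au] := a0W t i.
set y := weight _ in y0 *; set x := a t i in al au *; set z := c t i in cl cu *.
have h : expR (eta * (x - z)) <= 1 + eta * (x - z) + (eta * (x - z)) ^+ 2.
  apply: expR_le_quadratic; apply: le_trans etaW.
  by rewrite ler_pM2l//; lra.
have h2 : (eta * (x - z)) ^+ 2 <= eta ^+ 2 * W * z + eta ^+ 2 * W * x.
  have -> : eta ^+ 2 * W * z + eta ^+ 2 * W * x = eta ^+ 2 * (W * z + W * x).
    by ring.
  by rewrite exprMn ler_wpM2l ?sqr_ge0//; nra.
apply: (@le_trans _ _ (y * (1 + eta * (x - z) +
    (eta ^+ 2 * W * z + eta ^+ 2 * W * x)))).
  by rewrite ler_wpM2l//; lra.
by rewrite le_eqVlt; apply/orP; left; apply/eqP; ring.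
Qed.

(** A weight is the exponential of [eta * g - ln #|I|], hence lies above its tangent line; weights
    outside [S] are dropped. *)
Lemma weight_comparator (S : {set I}) t :
  \sum_(i in S) (1 + eta * g t i - ln #|I|%:R) <= \sum_i weight (g t i).
Proof.
rewrite big_mkcond; apply: ler_sum => i _.
case: ifP => _; last exact: weight_ge0.
rewrite /weight -[X in _ / X]lnK ?posrE// -expRN -expRD -addrA.
exact: expR_ge1Dx.
Qed.

(** The total weight, starting at 1, is bounded above by telescoping and below by the comparator;
    comparing the two and dividing by [eta] gives the claim. *)
Lemma regret (S : {set I}) (T : nat) :
  \sum_(t < T) \sum_i weight (g t i) * (c t i - a t i) <=
  \sum_(t < T) \sum_(i in S) (c t i - a t i)
  + (#|S|%:R * ln #|I|%:R + 1) / eta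
  + eta * W * (\sum_(t < T) \sum_i weight (g t i) * c t i)
  + eta * W ^+ 2 * T%:R.
Proof.
have tel : \sum_i weight (g T i) <= 1
    - eta * (\sum_(t < T) \sum_i weight (g t i) * (c t i - a t i))
    + eta ^+ 2 * W * (\sum_(t < T) \sum_i weight (g t i) * c t i)
    + eta ^+ 2 * W ^+ 2 * T%:R.
  elim: T => [|t IH].
    rewrite !big_ord0 !mulr0 subr0 !addr0.
    under eq_bigr do rewrite g0 /weight mulr0 expR0 mul1r.
    by rewrite sumr_const -[X in X <= _]mulr_natr mulVf// gt_eqF.
  apply: le_trans (total_weight_step t) _.
  rewrite !big_ord_recr /= -natr1.
  have -> : \sum_i weight (g t i) * (a t i - c t i) =
      - \sum_i weight (g t i) * (c t i - a t i).
    by rewrite -sumrN; apply: eq_bigr => i _; rewrite -mulrN opprB.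
  lra.
have gE i : g T i = - \sum_(t < T) (c t i - a t i).
  elim: T {tel} => [|t IH]; first by rewrite big_ord0 g0 oppr0.
  by rewrite gS IH big_ord_recr /= opprD opprB.
have := weight_comparator S T.
have -> : \sum_(i in S) (1 + eta * g T i - ln #|I|%:R) =
    #|S|%:R * (1 - ln #|I|%:R)
    - eta * \sum_(t < T) \sum_(i in S) (c t i - a t i).
  rewrite exchange_big mulr_sumr -sumrN /=.
  rewrite mulr_natl -[X in X + _]sumr_const -big_split /=.
  by apply: eq_bigr => i _; rewrite gE; ring.
move=> /le_trans /(_ tel).
set X := \sum_t \sum_i _ * (_ - _); set Y := \sum_t \sum_(i in S) _.
set Z := \sum_t _ => h.
rewrite -(ler_pM2l eta0).
have -> : eta * (Y + (#|S|%:R * ln #|I|%:R + 1) / eta + eta * W * Z +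
    eta * W ^+ 2 * T%:R) = eta * Y + (#|S|%:R * ln #|I|%:R + 1)
    + eta ^+ 2 * W * Z + eta ^+ 2 * W ^+ 2 * T%:R.
  by field; rewrite gt_eqF.
have : 0 <= #|S|%:R :> R by [].
lra.
Qed.

End Regret.

(** * The competitive bound *)

Section Competitive.
Local Close Scope classical_set_scope.
Local Open Scope set_scope.
Local Open Scope ring_scope.
Variables (R : realType) (N T : nat) (C D : R).
Hypothesis N2 : (2 <= N)%N.
Hypothesis T2 : (2 <= T)%N.

Let L := approx_ln (N%:R : R).
(** The learning rate in units of [1 / (C + D)], with the square root written as a power, as the
    program computes it. *)
Definition rate : R := (L / T%:R) `^ (1 / 2).

Let T0 : 0 < T%:R :> R. Proof. by rewrite ltr0n (leq_trans _ T2). Qed.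
Let LN : ln N%:R <= L <= 2 * ln N%:R.
Proof. by apply: approx_ln_bounds; rewrite ler_nat. Qed.
Let lnN : 2^-1 <= ln N%:R :> R. Proof. exact: ln_nat_ge_half. Qed.
Let lnT : 2^-1 <= ln T%:R :> R. Proof. exact: ln_nat_ge_half. Qed.
Let L0 : 0 < L. Proof. by have /andP[] := LN; move: lnN; lra. Qed.

Lemma rateE : rate = Num.sqrt (L / T%:R).
Proof. by rewrite /rate mul1r powR12_sqrt// divr_ge0// ltW. Qed.

Lemma rate_gt0 : 0 < rate.
Proof. by rewrite rateE sqrtr_gt0 divr_gt0. Qed.

Let rate2 : rate ^+ 2 * T%:R = L.
Proof. by rewrite rateE sqr_sqrtr ?divr_ge0 ?ltW// mulfVK ?gt_eqF. Qed.

Let Q := Num.sqrt (ln N%:R * T%:R) : R.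

Let Q1 : 1 <= Q.
Proof.
rewrite -sqrtr1 ler_sqrt; last by rewrite mulr_ge0// ltW//; move: lnN; lra.
have : 2 <= T%:R :> R by rewrite ler_nat.
by move: lnN; nra.
Qed.

Let rateT : rate * T%:R <= 2 * Q.
Proof.
have Q0 : 0 <= Q by apply: sqrtr_ge0.
rewrite -ler_sqr ?nnegrE ?mulr_ge0 ?(ltW rate_gt0) ?(ltW T0)//.
have -> : (rate * T%:R) ^+ 2 = L * T%:R by rewrite -rate2; ring.
rewrite exprMn sqr_sqrtr; last by rewrite mulr_ge0// ltW//; move: lnN; lra.
rewrite [leRHS]mulrA ler_pM2r//; have /andP[] := LN; move: lnN; lra.
Qed.

(** Few trials mean [rate > 1 / 4], so [T <= 4 * rate * T <= 8 Q]; the last factor 2 comes from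
    [ln T >= 1 / 2]. *)
Lemma few_trials_bound (k : nat) : 0 <= C + D -> (0 < k)%N -> T%:R < 16 * L ->
  (C + D) * T%:R <= 16 * (k%:R * (C + D) * ln T%:R * Q).
Proof.
move=> W0 k0 TL.
have k1 : 1 <= k%:R :> R by rewrite ler1n.
have r0 := rate_gt0.
have h : T%:R <= 8 * Q.
  have : 4^-1 < rate.
    rewrite -ltr_sqr ?nnegrE ?invr_ge0 ?(ltW r0)//; move: rate2 T0 TL; nra.
  by move: rateT T0; nra.
have : 0 <= (C + D) * (8 * Q - T%:R) by rewrite mulr_ge0//; lra.
have : 2^-1 <= k%:R * ln T%:R :> R by move: lnT; nra.
have : 0 <= (C + D) * Q by rewrite mulr_ge0//; move: Q1; lra.
nra.
Qed.

Hypothesis W0 : 0 < C + D.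
Hypothesis TL : 16 * L <= T%:R.
Variables (c d g : nat -> 'I_N -> R) (r e : nat -> R).
Let W := C + D.
Let y t i := weight 'I_N (rate / W) (g t i).
Let a t i := gap (d t) (r t) i.
Hypothesis c0W : forall t i, 0 <= c t i <= W.
Hypothesis d0 : forall t i, 0 <= d t i.
Hypothesis g0 : forall i, g 0 i = 0.
Hypothesis gS : forall t i, g t.+1 i = g t i + (a t i - c t i).
Hypothesis r0W : forall t, 0 <= r t <= W.
Hypothesis yr : forall t, \sum_(i | d t i < r t) y t i <= 1.
Hypothesis eP : forall t, e t <= ln T%:R * (\sum_i c t i * y t i)
  + (r t - \sum_i y t i * a t i) + 3 * W / T%:R.

(** For each [i] in [S], the gap of [i] alone lowers [r t] to at most [d t i], and the other gaps
    only lower it further. *)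
Lemma comparator_le (S : {set 'I_N}) t : S != finset.set0 ->
  r t + \sum_(i in S) (c t i - a t i) <= loss (c t) (d t) S.
Proof.
move=> S0; rewrite sumrB addrCA lerD2l; apply: min_over_ge => // i iS.
have : a t i <= \sum_(i in S) a t i.
  by rewrite (bigD1 i)//= lerDl sumr_ge0// => j _; exact: gap_ge0.
rewrite {1}/a /gap; have [|] := leP 0 (r t - d t i); lra.
Qed.

(** [A] is the fractional opening cost and [B] the fractional connection cost. The regret bound
    controls [A + B] up to [rate * A], and only afterwards is [A] multiplied by [ln T]. *)
Lemma competitive_bound (S : {set 'I_N}) : S != finset.set0 ->
  \sum_(t < T) e t <= 48 * (ln T%:R * (\sum_(t < T) loss (c t) (d t) S)
    + #|S|%:R * (C + D) * ln T%:R * Q).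
Proof.
move=> S0; have k1 : 1 <= #|S|%:R :> R by rewrite ler1n card_gt0.
have q0 := rate_gt0; have Wge0 : 0 <= W by exact: ltW.
(* The threshold [16 L <= T] is chosen for this: it keeps the exponents in the range of the
   quadratic bound. *)
have q4 : rate <= 4^-1.
  rewrite -ler_sqr ?nnegrE ?(ltW q0) ?invr_ge0//; move: rate2 T0 TL; nra.
have y0 t i : 0 <= y t i by exact: weight_ge0.
have ya t : \sum_i y t i * a t i <= r t.
  apply: (@le_trans _ _ (\sum_(i | d t i < r t) y t i * r t)).
    rewrite [leRHS]big_mkcond; apply: ler_sum => i _; rewrite /a /gap.
    case: ifP => dr.
      rewrite ler_wpM2l// ge_max; have /andP[-> _] /= := r0W t.
      by have := d0 t i; lra.
    by rewrite max_l ?mulr0// subr_le0 leNgt dr.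
  by rewrite -mulr_suml ler_piMl//; have /andP[] := r0W t.
have aW t i : 0 <= a t i <= W.
  rewrite gap_ge0 /a /gap ge_max ltW//=.
  by have := d0 t i; have /andP[_] := r0W t; lra.
have IN : (0 < #|'I_N|)%N by rewrite card_ord (leq_trans _ N2).
have qW : rate / W * W = rate by rewrite mulfVK// gt_eqF.
have := @regret R 'I_N W (rate / W) c a g IN _ _ c0W aW g0 gS _ S T.
rewrite qW divr_gt0// => /(_ isT q4) h.
have {h} := h (fun t => le_trans (ya t) (proj2 (andP (r0W t)))).
rewrite card_ord.
have -> : rate / W * W ^+ 2 * T%:R = W * (rate * T%:R).
  by rewrite expr2 mulrA qW; ring.
set A := \sum_(t < T) \sum_i _ * c t i.
set X := \sum_(t < T) \sum_i _ * (_ - _).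
set Y := \sum_(t < T) \sum_(i in S) _ => h.
have A0 : 0 <= A.
  apply: sumr_ge0 => t _; apply: sumr_ge0 => i _; rewrite mulr_ge0 ?weight_ge0//.
  by have /andP[] := c0W t i.
pose B := \sum_(t < T) (r t - \sum_i y t i * a t i).
have B0 : 0 <= B by apply: sumr_ge0 => t _; rewrite subr_ge0.
have XE : X = A + B - \sum_(t < T) r t.
  rewrite /A /B -big_split /= -sumrB; apply: eq_bigr => t _ /=.
  under eq_bigr do rewrite mulrBr.
  rewrite sumrB /y; ring.
have YE : Y + \sum_(t < T) r t <= \sum_(t < T) loss (c t) (d t) S.
  rewrite addrC -big_split; apply: ler_sum => t _; exact: comparator_le.
have eE : \sum_(t < T) e t <= ln T%:R * A + B + 3 * W.
  apply: (@le_trans _ _ (\sum_(t < T) (ln T%:R * (\sum_i c t i * y t i)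
    + (r t - \sum_i y t i * a t i) + 3 * W / T%:R))).
    by apply: ler_sum => t _; exact: eP.
  have WE : \sum_(t < T) 3 * W / T%:R = 3 * W.
    by rewrite sumr_const card_ord -[LHS]mulr_natr mulfVK ?gt_eqF.
  rewrite !big_split /= WE.
  have -> : A = \sum_(t < T) \sum_i c t i * y t i.
    by apply: eq_bigr => t _; apply: eq_bigr => i _; rewrite mulrC.
  by rewrite -mulr_sumr /B big_split.
(* Since [1 <= 2 * #|S| * ln N] the numerator is at most [3 * #|S| * L], and [L = rate^2 * T]
   cancels one factor [rate]. *)
have kE : (#|S|%:R * ln N%:R + 1) / (rate / W) <= 6 * #|S|%:R * W * Q.
  rewrite invf_div mulrA ler_pdivrMr//.
  have : #|S|%:R * ln N%:R + 1 <= 3 * #|S|%:R * L.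
    by have /andP[] := LN; move: lnN k1; nra.
  rewrite -rate2; move=> h3.
  have := ler_wpM2r (ltW W0) h3; rewrite -/W.
  have : 0 <= 3 * #|S|%:R * rate * W by rewrite !mulr_ge0// (ltW q0).
  by move: rateT; nra.
have WT : W * (rate * T%:R) <= 2 * #|S|%:R * W * Q.
  apply: (@le_trans _ _ (W * (2 * Q))); first by rewrite ler_pM2l.
  by have : 0 <= W * Q by [rewrite mulr_ge0 ?sqrtr_ge0]; move: k1; nra.
have W1 : 3 * W <= 3 * #|S|%:R * W * Q.
  have : 1 <= #|S|%:R * Q by move: Q1; nra.
  move: W0; rewrite -/W; nra.
set O := \sum_(t < T) loss _ _ _ in YE *.
set K := #|S|%:R * W * Q in kE WT W1.
have K0 : 0 <= K by rewrite !mulr_ge0 ?sqrtr_ge0.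
have -> : #|S|%:R * (C + D) * ln T%:R * Q = ln T%:R * K by rewrite /K /W; ring.
have rA : rate * A <= 4^-1 * A by rewrite ler_wpM2r.
(* The second-order term [rate * A] is moved to the left; 8 is 6 from [kE] plus 2 from [WT].
   Altogether [4 / 3 + 2] times [O + 8 K], plus [6 K], stays below the constant 48. *)
have M : 3 / 4 * A + B <= O + 8 * K by rewrite /K in kE WT *; lra.
have M0 : 0 <= O + 8 * K by lra.
have lA : ln T%:R * A <= ln T%:R * (4 / 3 * (O + 8 * K)).
  by rewrite ler_wpM2l//; move: lnT; lra.
have lB : B <= 2 * ln T%:R * (O + 8 * K) by move: lnT; nra.
have lW : 3 * W <= 6 * ln T%:R * K.
  by rewrite /K in K0 *; move: lnT W1; nra.
have O0 : 0 <= O.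
  apply: sumr_ge0 => t _; apply: loss_ge0 => // i.
  by have /andP[] := c0W t i.
have lO : 0 <= ln T%:R * O by rewrite mulr_ge0//; move: lnT; lra.
have lK : 0 <= ln T%:R * K by rewrite mulr_ge0//; move: lnT; lra.
lra.
Qed.

End Competitive.

(** * Independent inclusion *)

Section FiniteValued.
Context {disp : measure_display} {Omega : measurableType disp} {R : realType}.
Variable P : probability Omega R.
Variables (J : finType) (Y : Omega -> J).
Hypothesis mY : forall j, measurable [set w | Y w = j].

Definition law (j : J) : R := fine (P [set w | Y w = j]).

Lemma law_ge0 j : 0 <= law j.
Proof. exact: fine_ge0. Qed.

Lemma lawE j : (law j)%:E = P [set w | Y w = j].
Proof. by rewrite fineK// fin_num_measure. Qed.

Let finite_valuedE (f : J -> R) w :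
  f (Y w) = \sum_j f j * \1_[set w | Y w = j] w.
Proof.
rewrite (bigD1 (Y w))//= big1 ?addr0 => [|j jY].
  by rewrite indicE mem_set// mulr1.
by rewrite indicE memNset ?mulr0//= => /esym/eqP; rewrite (negPf jY).
Qed.

Lemma measurable_finite_valued (f : J -> R) :
  measurable_fun [set: Omega] (EFin \o (f \o Y)).
Proof.
apply/measurable_EFinP.
rewrite [X in measurable_fun _ X](_ : _ =
  fun w => \sum_j f j * \1_[set w | Y w = j] w); last first.
  by apply/funext => w /=; rewrite finite_valuedE.
apply: measurable_sum => j; apply: measurable_funM => //.
Qed.

Lemma integral_finite_valued (f : J -> R) : (forall j, 0 <= f j) ->
  (\int[P]_w (f (Y w))%:E = (\sum_j law j * f j)%:E)%E.
Proof.
move=> f0.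
under eq_integral do rewrite finite_valuedE -sumEFin.
rewrite ge0_integral_sum//; last 2 first.
- move=> j; apply/measurable_EFinP; apply: measurable_funM => //.
- by move=> j w _; rewrite lee_fin mulr_ge0.
rewrite -sumEFin; apply: eq_bigr => j _.
under eq_integral do rewrite EFinM.
rewrite ge0_integralZl//.
- by rewrite integral_indic// setIT mulrC EFinM lawE.
- exact/measurable_EFinP/measurable_indic.
- by rewrite lee_fin.
Qed.

Lemma measurable_finite_image (K : eqType) (h : J -> K) (k : K) :
  measurable [set w | h (Y w) = k].
Proof.
rewrite [X in measurable X](_ : _ = \bigcup_(j in [set j | h j = k])
    [set w | Y w = j]).
  by apply: fin_bigcup_measurable => //; exact: finite_finset.
apply/seteqP; split => w /=; last by move=> [j /= <- <-].
by move=> hk; exists (Y w).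
Qed.

End FiniteValued.

Section IndependentInclusion.
Context {disp : measure_display} {Omega : measurableType disp} {R : realType}.
Variables (P : probability Omega R) (U : nat -> {RV P >-> R}).
Hypothesis iidU : iid_uniform01 U.

Lemma prob_uniform_ge (j : nat) (q : R) : 0 <= q <= 1 ->
  P (U j @^-1` `[1 - q, +oo[) = q%:E.
Proof.
move=> /andP[q0 q1]; have [_ uU] := iidU.
have := uU j `[1 - q, +oo[%classic (measurable_itv _).
rewrite /distribution /pushforward => ->.
rewrite /uniform_prob integral_uniform_pdf.
have -> : `[1 - q, +oo[ `&` `[0, 1] = `[1 - q, 1]%classic :> set R.
  apply/seteqP; split => x /=; rewrite !in_itv/= ?andbT.
    by move=> [-> /andP[]].
  by move=> /andP[h ->]; split => //; rewrite (le_trans _ h)// subr_ge0.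
rewrite (eq_integral (fun=> 1%:E)); last first.
  move=> x; rewrite inE/= in_itv/= /uniform_pdf => /andP[h ->].
  by rewrite (le_trans _ h) ?subr_ge0// subr0 invr1.
rewrite integral_cst//= lebesgue_measure_itv/= lte_fin mul1e.
(* In the remaining case [q = 0] and the interval is a single point. *)
case: ltP => h; first by rewrite -EFinB opprB addrC subrK.
by congr EFin; lra.
Qed.

Variables (N m : nat) (q : nat -> R).
Hypothesis q01 : forall i, 0 <= q i <= 1.

(** [q i] is the probability that [i] is left out, and [m] is the number of tape entries consumed
    earlier. *)
Definition included (w : Omega) : {set 'I_N} :=
  [set i : 'I_N | U (m + i)%N w < 1 - q i]%SET.

Lemma measurable_included (X : {set 'I_N}) :
  measurable [set w | included w = X].
Proof.
have mU i : measurable [set w | U (m + i)%N w < 1 - q i].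
  have := measurable_funPTI (U (m + i)%N) (measurable_itv `]-oo, 1 - q i[).
  congr measurable; apply/seteqP; split => w /=; by rewrite in_itv.
rewrite [Y in measurable Y](_ : _ = \bigcap_(i in [set: 'I_N])
  (if i \in X then [set w | U (m + i)%N w < 1 - q i]
   else ~` [set w | U (m + i)%N w < 1 - q i])).
  apply: fin_bigcap_measurable => [|i _]; first exact: finite_finset.
  by case: ifP => _; [|apply: measurableC].
apply/seteqP; split => w /= => [<- i _|h].
  by rewrite inE; case: ifP => // /negP.
apply/setP => i; rewrite inE; have := h i I.
by case: ifP => _ //= /negP/negbTE.
Qed.

(** Missing [S] is the intersection over [S] of the independent events that entry [m + i] is at
    least [1 - q i]. *)
Lemma law_included_miss (S : {set 'I_N}) :
  \sum_X law P included X * miss X S = \prod_(i in S) q i.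
Proof.
apply: EFin_inj; rewrite -(integral_finite_valued _ measurable_included); last first.
  by move=> X; rewrite /miss.
pose J := [seq (m + i)%N | i : 'I_N <- enum S].
pose B j := `[1 - q (j - m)%N, +oo[%classic : set R.
have [indep _] := iidU.
have JE : \bigcap_(j in [set` J]) (U j @^-1` B j) =
    [set w | [disjoint included w & S]%bool].
  apply/seteqP; split => w /= h.
    apply/pred0P => i /=; apply/negbTE/negP => /andP[].
    rewrite inE ltNge => /negP iw iS; apply: iw.
    have := h (m + i)%N; rewrite /B /= addKn in_itv/= andbT; apply.
    by apply/mapP; exists i; rewrite ?mem_enum.
  move=> j /mapP[i]; rewrite mem_enum => iS ->.
  rewrite /B /= addKn in_itv/= andbT leNgt; apply/negP => iw.
  by move/pred0P/(_ i): h => /=; rewrite iS inE iw.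
have PE : P [set w | [disjoint included w & S]%bool] = (\prod_(i in S) q i)%:E.
  rewrite -JE indep; last 2 first.
  - by rewrite map_inj_uniq ?enum_uniq// => i j /addnI/val_inj.
  - by move=> j; exact: measurable_itv.
  rewrite big_map big_enum /= -prodEFin; apply: eq_bigr => i _.
  by rewrite /B addKn prob_uniform_ge.
rewrite -PE; under eq_integral => w _.
  rewrite (_ : miss _ _ = \1_[set w | [disjoint included w & S]%bool] w); last first.
    rewrite indicE /miss; congr ((nat_of_bool _)%:R).
    by apply/idP/idP; rewrite inE.
  over.
rewrite integral_indic ?setIT//.
rewrite -JE; apply: fin_bigcap_measurable => [|j _]; first exact: finite_seq.
by apply: measurable_funPTI; exact: measurable_itv.
Qed.

End IndependentInclusion.

(** * The program *)

Section Execution.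
Variables (R : realType) (u : nat -> R).
Implicit Types (p q : com) (s : state R) (Q : state R -> Prop).

(** Total correctness with a time budget. *)
Definition runs p (k : nat) Q s : Prop :=
  exists s' n, [/\ exec u p s s' n, (n <= k)%N & Q s'].

Lemma runs_seq p q k l Q s :
  runs p k (runs q l Q) s -> runs (Seq p q) (k + l) Q s.
Proof.
move=> [s1 [m [pm mk [s2 [n [qn nl Qs]]]]]]; exists s2, (m + n)%N.
by split => //; [exact: exec_seq pm qn|rewrite leq_add].
Qed.

Lemma runs_le p k l Q Q' s : (k <= l)%N -> (forall s', Q s' -> Q' s') ->
  runs p k Q s -> runs p l Q' s.
Proof.
move=> kl QQ [s' [n [e nk q]]]; exists s', n; split => //; last exact: QQ.
exact: leq_trans kl.
Qed.

Lemma runs_while b p (I : nat -> state R -> Prop) n k s :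
  (forall j s, (j < n)%N -> I j s -> beval s b /\ runs p k (I j.+1) s) ->
  (forall s, I n s -> ~~ beval s b) -> I 0 s ->
  runs (While b p) (n * (bcost b + k).+1 + (bcost b).+1) (I n) s.
Proof.
move=> step stop.
suff H m j s' : (j + m = n)%N -> I j s' ->
    runs (While b p) (m * (bcost b + k).+1 + (bcost b).+1) (I n) s'.
  exact: (H n 0%N).
elim: m j s' => [|m IH] j s' jn Is.
  rewrite addn0 in jn; subst j.
  exists s', (bcost b).+1; split => //.
  exact: exec_while_false (stop _ Is).
have jn' : (j < n)%N by lia.
have [bs [s1 [l [el lk]]]] := step _ _ jn' Is.
have jn1 : (j.+1 + m = n)%N by lia.
move=> /(IH _ _ jn1)[s2 [l2 [el2 l2k I2]]].
exists s2, (bcost b + l + l2).+1; split => //; last first.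
  rewrite mulSn; lia.
exact: exec_while_true el el2.
Qed.

Fixpoint loop_free p : bool :=
  match p with
  | Seq p1 p2 | If _ p1 p2 => loop_free p1 && loop_free p2
  | While _ _ => false
  | _ => true
  end.

(** A functional semantics, so that straight-line code is verified by computation. The value on
    [While] is a dummy. *)
Fixpoint eval p s : state R :=
  match p with
  | Skip | While _ _ => s
  | Seq p1 p2 => eval p2 (eval p1 s)
  | ISet x e => set_ivar s x (ieval s e)
  | RSet a i e => set_cell s a (ieval s i) (reval s e)
  | Draw a i => next_draw (set_cell s a (ieval s i) (u (ndraws s)))
  | If b p1 p2 => if beval s b then eval p1 s else eval p2 s
  end.

(** The costs of both branches of an [If] are added, which is enough for an upper bound. *)
Fixpoint cost_bound p : nat :=
  match p with
  | Skip | While _ _ => 1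
  | Seq p1 p2 => cost_bound p1 + cost_bound p2
  | ISet _ e => (icost e).+1
  | RSet _ i e => (icost i + rcost e).+1
  | Draw _ i => (icost i).+1
  | If b p1 p2 => (bcost b + (cost_bound p1 + cost_bound p2)).+1
  end%N.

Lemma runs_loop_free p Q s : loop_free p -> Q (eval p s) ->
  runs p (cost_bound p) Q s.
Proof.
move=> lp qs; suff [n pn nk] : exists2 n, exec u p s (eval p s) n &
  (n <= cost_bound p)%N by exists (eval p s), n.
elim: p s lp {qs} => //=.
- by move=> s _; exists 1%N => //; exact: exec_skip.
- move=> p IHp q IHq s /andP[/IHp-/(_ s)[m pm mk] /IHq-/(_ (eval p s))[n qn nk]].
  by exists (m + n)%N; [exact: exec_seq pm qn|rewrite leq_add].
- by move=> x e s _; exists (icost e).+1 => //; exact: exec_iset.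
- by move=> a i e s _; exists (icost i + rcost e).+1 => //; exact: exec_rset.
- by move=> a i s _; exists (icost i).+1 => //; exact: exec_draw.
- move=> b p IHp q IHq s /andP[/IHp-/(_ s)[m pm mk] /IHq-/(_ s)[n qn nk]].
  case: ifPn => bs.
    by exists (bcost b + m).+1; [exact: exec_if_true pm|lia].
  by exists (bcost b + n).+1; [exact: exec_if_false qn|lia].
Qed.

End Execution.

(* Registers: 2 runs through the sites, 3 tells whether a site has been
   selected, 4 holds 2 ^ k after k bisection steps.  Arrays: 4 holds
   the gains, 5 the current random number, 6 the bisection interval (left end
   and width) and the mass below its midpoint. *)
Definition siteN := RGet 0 (IConst 0).
Definition trialsT := RGet 0 (IConst 1).
Definition costC := RGet 0 (IConst 2).
Definition costD := RGet 0 (IConst 3).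
Definition left_end := RGet 6 (IConst 0).
Definition width := RGet 6 (IConst 1).
Definition mass := RGet 6 (IConst 2).

Definition log_exp := RMul siteN (RSub (RPow siteN (RDiv (RNat 1) siteN)) (RNat 1)).
Definition rate_exp := RPow (RDiv log_exp trialsT) (RDiv (RNat 1) (RNat 2)).
Definition weight_exp :=
  RDiv (RExp (RMul (RDiv rate_exp (RAdd costC costD)) (RGet 4 (IVar 2)))) siteN.

Definition next_site := ISet 2 (IAdd (IVar 2) (IConst 1)).
Definition more_sites := BIlt (IVar 2) (IVar 0).

(** With few trials the first conjunct always fails, so that no site is drawn and [choose_com] falls
    back on site 0. *)
Definition select_test :=
  BAnd (BNot (BRlt trialsT (RMul (RNat 16) log_exp)))
    (BRlt (RGet 5 (IConst 0))
       (RSub (RNat 1) (RPow trialsT (RSub (RNat 0) weight_exp)))).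

Definition choose_body :=
  Seq (Draw 5 (IConst 0))
 (Seq (If select_test
         (Seq (RSet 3 (IVar 2) (RNat 1)) (ISet 3 (IConst 1)))
         (RSet 3 (IVar 2) (RNat 0)))
      next_site).

Definition choose_com :=
  Seq (Seq (ISet 2 (IConst 0)) (ISet 3 (IConst 0)))
 (Seq (While more_sites choose_body)
      (If (BIlt (IVar 3) (IConst 1)) (RSet 3 (IConst 0) (RNat 1)) Skip)).

Definition mass_body :=
  Seq (If (BRlt (RAdd left_end width) (RGet 2 (IVar 2))) Skip
         (RSet 6 (IConst 2) (RAdd mass weight_exp)))
      next_site.

(** Doubling register 4 until it reaches [T] counts the bisection steps without a logarithm. *)
Definition bisect_body :=
  Seq (Seq (RSet 6 (IConst 1) (RDiv width (RNat 2)))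
      (Seq (RSet 6 (IConst 2) (RNat 0)) (ISet 2 (IConst 0))))
 (Seq (While more_sites mass_body)
      (Seq (If (BRlt mass (RNat 1)) (RSet 6 (IConst 0) (RAdd left_end width)) Skip)
           (ISet 4 (IAdd (IVar 4) (IVar 4))))).

Definition gain_body :=
  Seq (RSet 4 (IVar 2) (RAdd (RGet 4 (IVar 2))
         (RSub (RNat 0) (RGet 1 (IVar 2)))))
 (Seq (If (BRlt (RGet 2 (IVar 2)) left_end)
         (RSet 4 (IVar 2) (RAdd (RGet 4 (IVar 2))
            (RSub left_end (RGet 2 (IVar 2))))) Skip)
      next_site).

Definition update_com :=
  Seq (Seq (RSet 6 (IConst 0) (RNat 0))
      (Seq (RSet 6 (IConst 1) (RAdd costC costD)) (ISet 4 (IConst 1))))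
 (Seq (While (BIlt (IVar 4) (IVar 1)) bisect_body)
      (Seq (ISet 2 (IConst 0)) (While more_sites gain_body))).

(** * Correctness and running time of the program *)

Section Correctness.
Variables (R : realType) (u : nat -> R) (N T : nat) (C D : R).
Hypothesis N2 : (2 <= N)%N.
Hypothesis T2 : (2 <= T)%N.
Implicit Types (c d g : nat -> R) (s : state R).

Let W := C + D.
Definition site_weight (x : R) : R := weight 'I_N (rate R N T / W) x.

Definition memory c d g s : Prop :=
  [/\ ivars s 0 = N /\ ivars s 1 = T,
      cells s 0 =1 nth 0 [:: N%:R; T%:R; C; D] &
      forall i, (i < N)%N ->
        [/\ cells s 1 i = c i, cells s 2 i = d i & cells s 4 i = g i]].

Lemma reval_siteN c d g s : memory c d g s -> reval s siteN = N%:R.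
Proof. by case=> _ /(_ 0%N). Qed.

Lemma reval_log c d g s : memory c d g s -> reval s log_exp = approx_ln N%:R.
Proof. by case=> _ p _; rewrite /= !p. Qed.

Lemma reval_trialsT c d g s : memory c d g s -> reval s trialsT = T%:R.
Proof. by case=> _ /(_ 1%N). Qed.

Lemma reval_weight c d g s : memory c d g s -> (ivars s 2 < N)%N ->
  reval s weight_exp = site_weight (g (ivars s 2)).
Proof.
move=> m iN; have [_ p sites] := m; have [_ _ gi] := sites _ iN.
rewrite /site_weight /weight card_ord /rate -(reval_log m).
by rewrite -(reval_trialsT m) -(reval_siteN m) -gi /= !p.
Qed.

Let N0 : (0 < N)%N := ltnW N2.

(** The form [0 - _] mirrors the program, whose expressions have no opposite. *)
Definition chosen (m : nat) g (i : nat) : bool :=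
  ~~ (T%:R < 16 * approx_ln (N%:R : R)) &&
  (u (m + i)%N < 1 - T%:R `^ (0 - site_weight (g i))).

Lemma select_testE c d g s m : memory c d g s -> (ivars s 2 < N)%N ->
  cells s 5 0 = u (m + ivars s 2)%N ->
  beval s select_test = chosen m g (ivars s 2).
Proof.
move=> mem iN c5; rewrite /chosen -c5 -(reval_weight mem iN).
by rewrite -(reval_log mem) -(reval_trialsT mem).
Qed.

Definition choose_inv c d g m k s : Prop :=
  [/\ memory c d g s, ivars s 2 = k, ndraws s = (m + k)%N,
      forall i, (i < k)%N -> (cells s 3 i != 0) = chosen m g i &
      (ivars s 3 != 0%N) = has (chosen m g) (iota 0 k)].

Lemma choose_step c d g m k s : (k < N)%N -> choose_inv c d g m k s ->
  beval s more_sites /\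
  runs u choose_body (cost_bound choose_body) (choose_inv c d g m k.+1) s.
Proof.
move=> kN [mem ik dk sk fk]; split.
  by rewrite /= ik; have [[-> _] _ _] := mem.
apply: runs_loop_free => //.
set s1 := next_draw (set_cell s 5 0 (u (ndraws s))).
have mem1 : memory c d g s1 by [].
have test : beval s1 select_test = chosen m g k.
  by rewrite (select_testE (m := m) mem1) /= ?ik// dk.
rewrite [eval _ _ _](_ : _ = eval u next_site
    (if chosen m g k then set_ivar (set_cell s1 3 (ivars s1 2) 1) 3 1
     else set_cell s1 3 (ivars s1 2) 0)); last by rewrite -test.
have hasS : has (chosen m g) (iota 0 k.+1) =
    has (chosen m g) (iota 0 k) || chosen m g k.
  by rewrite -addn1 iotaD has_cat /= orbF.
case: ifPn => ck; split.
- by [].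
- by rewrite /= ik addn1.
- by rewrite /= dk addnS.
- move=> i; rewrite ltnS leq_eqVlt /= ik => /predU1P[->|ik'].
    by rewrite eqxx oner_eq0 ck.
  by rewrite (ltn_eqF ik') sk.
- by rewrite hasS ck orbT.
- by [].
- by rewrite /= ik addn1.
- by rewrite /= dk addnS.
- move=> i; rewrite ltnS leq_eqVlt /= ik => /predU1P[->|ik'].
    by rewrite eqxx eqxx (negPf ck).
  by rewrite (ltn_eqF ik') sk.
- by rewrite hasS (negPf ck) orbF -fk.
Qed.

Lemma choose_runs c d g m s : memory c d g s -> ndraws s = m ->
  runs u choose_com (N * 200 + 50)
    (fun s' => [/\ memory c d g s', ndraws s' = (m + N)%N &
       selected N s' = fallback (Ordinal N0) [set i : 'I_N | chosen m g i]%SET])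
    s.
Proof.
move=> mem ds.
pose init := Seq (ISet 2 (IConst 0)) (ISet 3 (IConst 0)).
pose final := If (BIlt (IVar 3) (IConst 1)) (RSet 3 (IConst 0) (RNat 1)) Skip.
apply: (@runs_le _ _ _ (cost_bound init + ((N * (bcost more_sites +
  cost_bound choose_body).+1 + (bcost more_sites).+1) + cost_bound final))
  _ _ _ _ _ (fun s' h => h)).
  by rewrite /=; lia.
apply: runs_seq; apply: runs_loop_free => //.
apply: runs_seq.
apply: (@runs_le _ _ _ _ _ (choose_inv c d g m N) _ _ (leqnn _)); last first.
  apply: runs_while => [j s' jN|s' [[[n _] _ _] ik _ _ _]|].
  - exact: choose_step.
  - by rewrite /= ik n ltnn.
  - by split; rewrite //= addn0.
move=> {mem ds}s' [mem ik ds sk fk]; apply: runs_loop_free => //.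
rewrite [eval _ _ _](_ : _ = if (ivars s' 3 < 1)%N
  then set_cell s' 3 0 1 else s'); last by [].
rewrite ltnS leqn0 -[_ == _]negbK fk if_neg.
have sel (i : 'I_N) : (cells s' 3 i != 0) = chosen m g i by rewrite sk.
rewrite /fallback; case: hasP => [[i]|none].
  rewrite mem_iota => /= iN ci; split => //.
  case: ifP => [/eqP/setP/(_ (Ordinal iN))|_].
    by rewrite !inE /= ci.
  by apply/setP => j; rewrite !inE sel.
split => //.
have nochoice (i : 'I_N) : chosen m g i = false.
  apply/negP => ci; apply: none; exists (i : nat) => //.
  by rewrite mem_iota /=.
rewrite ifT; last by apply/eqP/setP => i; rewrite !inE nochoice.
apply/setP => i; rewrite !inE /= -val_eqE /=.
by case: ifP => _; rewrite ?oner_eq0// sel nochoice.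
Qed.

(** The least number of halvings that brings the width from [W] down to [W / T]. *)
Definition num_steps := up_log 2 T.

Definition site_bisect d g : nat -> R * R :=
  bisect W (fun i : 'I_N => d i) (fun i : 'I_N => site_weight (g i)).

Definition next_gain c d g (i : nat) : R :=
  g i + (Num.max 0 ((site_bisect d g num_steps).1 - d i) - c i).

Definition mass_inv c d g m e (r w : R) k s : Prop :=
  [/\ memory c d g s, ivars s 2 = k, ndraws s = m /\ ivars s 4 = e,
      cells s 6 0 = r /\ cells s 6 1 = w &
      cells s 6 2 = \sum_(i < k | d i <= r + w) site_weight (g i)].

Lemma mass_step c d g m e r w k s : (k < N)%N -> mass_inv c d g m e r w k s ->
  beval s more_sites /\
  runs u mass_body (cost_bound mass_body) (mass_inv c d g m e r w k.+1) s.
Proof.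
move=> kN [mem ik [ds ie] [lo wd] ms]; split.
  by rewrite /= ik; have [[-> _] _ _] := mem.
apply: runs_loop_free => //.
have wk : reval s weight_exp = site_weight (g k).
  by rewrite (reval_weight mem) ik.
have dk : cells s 2 (ivars s 2) = d k.
  by rewrite ik; have [_ _ /(_ _ kN)[]] := mem.
rewrite [eval _ _ _](_ : _ = eval u next_site
    (if r + w < d k then s else set_cell s 6 2 (cells s 6 2 + site_weight (g k)))).
  case: ltP => dr; split.
  - by [].
  - by rewrite /= ik addn1.
  - by [].
  - by [].
  - rewrite /= ms big_mkcond [RHS]big_mkcond big_ord_recr /=.
    by rewrite [d k <= _]leNgt dr addr0.
  - by [].
  - by rewrite /= ik addn1.
  - by [].
  - by [].
  - by rewrite /= ms big_mkcond [RHS]big_mkcond big_ord_recr /= dr.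
by rewrite -wk -lo -wd -dk.
Qed.

Definition bisect_inv c d g m j s : Prop :=
  [/\ memory c d g s, ndraws s = m, ivars s 4 = (2 ^ j)%N,
      cells s 6 0 = (site_bisect d g j).1 & cells s 6 1 = (site_bisect d g j).2].

Definition bisect_cost := (50 + N * 100)%N.

Lemma bisect_step c d g m j s : (j < num_steps)%N -> bisect_inv c d g m j s ->
  beval s (BIlt (IVar 4) (IVar 1)) /\
  runs u bisect_body bisect_cost (bisect_inv c d g m j.+1) s.
Proof.
move=> jJ [mem ds pj lo wd]; split.
  rewrite /= pj; have [[_ ->] _ _] := mem.
  (* By minimality [2 ^ (num_steps - 1) < T], so the loop does not stop early. *)
  have /andP[h _] := up_log_bounds (isT : 1 < 2)%N T2.
  apply: leq_ltn_trans h; rewrite leq_pexp2l// -ltnS prednK//.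
  exact: leq_ltn_trans jJ.
pose r := (site_bisect d g j).1; pose w := (site_bisect d g j).2 / 2.
pose init := Seq (RSet 6 (IConst 1) (RDiv width (RNat 2)))
                 (Seq (RSet 6 (IConst 2) (RNat 0)) (ISet 2 (IConst 0))).
pose final := Seq (If (BRlt mass (RNat 1))
                     (RSet 6 (IConst 0) (RAdd left_end width)) Skip)
                  (ISet 4 (IAdd (IVar 4) (IVar 4))).
apply: (@runs_le _ _ _ (cost_bound init + ((N * (bcost more_sites +
  cost_bound mass_body).+1 + (bcost more_sites).+1) + cost_bound final))
  _ _ _ _ _ (fun s' h => h)).
  by rewrite /bisect_cost /=; lia.
apply: runs_seq; apply: runs_loop_free => //.
apply: runs_seq.
apply: (@runs_le _ _ _ _ _ (mass_inv c d g m (2 ^ j)%N r w N) _ _ (leqnn _));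
  last first.
  apply: runs_while => [k s' kN|s' [[[n _] _ _] ik _ _ _]|].
  - exact: mass_step.
  - by rewrite /= ik n ltnn.
  - by split; rewrite //= ?big_ord0 ?lo ?wd.
move=> {mem ds pj lo wd}s' [mem ik [ds pj] [lo wd] ms]; apply: runs_loop_free => //.
rewrite [eval _ _ _](_ : _ = set_ivar (if cells s' 6 2 < 1
    then set_cell s' 6 0 (r + w) else s') 4 (2 ^ j.+1)).
  have jS : (site_bisect d g j.+1).1 =
      if \sum_(i < N | d i <= r + w) site_weight (g i) < 1 then r + w else r by [].
  by rewrite ms; case: ifP => lt1; split => //; rewrite jS lt1.
rewrite expnS mul2n -addnn -pj -lo -wd /=.
by case: ifP.
Qed.

Definition gain_inv c d g m (r : R) k s : Prop :=
  [/\ memory c d (fun i => if (i < k)%N then g i + (Num.max 0 (r - d i) - c i)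
                           else g i) s,
      ivars s 2 = k, ndraws s = m & cells s 6 0 = r].

Lemma gain_step c d g m r k s : (k < N)%N -> gain_inv c d g m r k s ->
  beval s more_sites /\
  runs u gain_body (cost_bound gain_body) (gain_inv c d g m r k.+1) s.
Proof.
move=> kN [mem ik ds lo]; split.
  by rewrite /= ik; have [[-> _] _ _] := mem.
apply: runs_loop_free => //.
have [ins params sites] := mem; have [ck dk gk] := sites _ kN.
rewrite ltnn in gk.
rewrite [eval _ _ _](_ : _ = eval u next_site
    (let s1 := set_cell s 4 k (g k + (0 - c k)) in
     if d k < r then set_cell s1 4 k (g k + (0 - c k) + (r - d k)) else s1)).
  case: ltP => dr; split => //=; rewrite ?ik ?addn1//.
    split => // i iN; have [ci di gi] := sites _ iN; split => //=.
    rewrite ltnS leq_eqVlt; case: eqP => [->|_] /=; last by rewrite gi.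
    by rewrite max_r ?subr_ge0 ?ltW//; ring.
  split => // i iN; have [ci di gi] := sites _ iN; split => //=.
  rewrite ltnS leq_eqVlt; case: eqP => [->|_] /=; last by rewrite gi.
  by rewrite max_l// subr_le0.
by rewrite /= ik lo dk gk ck eqxx /=.
Qed.

Definition update_cost := (num_steps * (10 + bisect_cost) + N * 100 + 100)%N.

Lemma update_runs c d g m s : memory c d g s -> ndraws s = m ->
  runs u update_com update_cost
    (fun s' => memory c d (next_gain c d g) s' /\ ndraws s' = m) s.
Proof.
move=> mem ds.
pose init := Seq (RSet 6 (IConst 0) (RNat 0))
      (Seq (RSet 6 (IConst 1) (RAdd costC costD)) (ISet 4 (IConst 1))).
pose b := BIlt (IVar 4) (IVar 1).
apply: (@runs_le _ _ _ (cost_bound init +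
  ((num_steps * (bcost b + bisect_cost).+1 + (bcost b).+1)
  + (cost_bound (ISet 2 (IConst 0)) +
  (N * (bcost more_sites + cost_bound gain_body).+1 + (bcost more_sites).+1))))
  _ _ _ _ _ (fun s' h => h)).
  by rewrite /update_cost /=; nia.
apply: runs_seq; apply: runs_loop_free => //.
apply: runs_seq.
apply: (@runs_le _ _ _ _ _ (bisect_inv c d g m num_steps) _ _ (leqnn _)); last first.
  apply: runs_while => [j s' jJ|s' [[[_ n] _ _] _ pj _ _]|].
  - exact: bisect_step.
  - rewrite /= pj n -leqNgt.
    by have /andP[] := up_log_bounds (isT : 1 < 2)%N T2.
  - by have [_ params _] := mem; split => //=; rewrite !params.
move=> {mem ds}s' [mem ds _ lo _].
apply: runs_seq; apply: runs_loop_free => //.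
apply: (@runs_le _ _ _ _ _
  (gain_inv c d g m (site_bisect d g num_steps).1 N) _ _ (leqnn _)); last first.
  apply: runs_while => [j s1 jJ|s1 [[[n _] _ _] ik _ _]|].
  - exact: gain_step.
  - by rewrite /= ik n ltnn.
  - by [].
move=> s1 [[ins params sites] _ ds1 _]; split => //; split => // i iN.
by have [-> -> ->] := sites _ iN; rewrite iN.
Qed.

End Correctness.

(** * The game *)

Section Playing.
Variables (R : realType) (N T : nat) (C D : R).
Variables (c d : 'I_T -> 'I_N -> R).
Hypothesis N2 : (2 <= N)%N.
Hypothesis T2 : (2 <= T)%N.

Let N0 : (0 < N)%N := ltnW N2.

(** Extension by zero lets trials and sites range over [nat], as the recursion for the gains and the
    memory cells do. *)
Definition extend (f : 'I_T -> 'I_N -> R) (t i : nat) : R :=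
  match insub t, insub i with Some t', Some i' => f t' i' | _, _ => 0 end.

Lemma extendE f (t : 'I_T) : (fun i : 'I_N => extend f t i) = f t.
Proof. by apply/funext => i; rewrite /extend !valK. Qed.

Lemma extend_bounds f B : 0 <= B -> (forall t i, 0 <= f t i <= B) ->
  forall t i, 0 <= extend f t i <= B.
Proof.
move=> B0 fB t i; rewrite /extend.
by case: insub => [t'|]; [case: insub => [i'|]|]; rewrite ?lexx ?B0 ?fB.
Qed.

(** The gains depend on the revealed costs and not on the tape, so the inclusion probabilities of
    every trial are deterministic. *)
Fixpoint gain (t : nat) : nat -> R :=
  if t is t'.+1 then next_gain N T C D (extend c t') (extend d t') (gain t')
  else fun=> 0.

Definition raw_selection (u : nat -> R) (t : nat) : {set 'I_N} :=
  [set i : 'I_N | chosen u N T C D (t * N) (gain t) i]%SET.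

Definition selection u t := fallback (Ordinal N0) (raw_selection u t).

Definition trial_cost := (N * 200 + 50 + update_cost N T)%N.

Definition facility_algorithm := Algorithm choose_com update_com.

Definition ready t (s : state R) : Prop :=
  (exists c0 d0, memory N T C D c0 d0 (gain t) s) /\ ndraws s = (t * N)%N.

Lemma trial_runs u t s : ready t s -> exists s' m n s'',
  [/\ exec u choose_com s s' m, selected N s' = selection u t,
      exec u update_com
        (reveal (fun i : 'I_N => extend c t i) (fun i : 'I_N => extend d t i) s')
        s'' n, (m + n <= trial_cost)%N & ready t.+1 s''].
Proof.
move=> [[c0 [d0 mem]] ds].
have [s' [m [em lem [mem' ds' sel]]]] := choose_runs u N2 T2 mem ds.
have mem2 : memory N T C D (extend c t) (extend d t) (gain t)
    (reveal (fun i : 'I_N => extend c t i) (fun i : 'I_N => extend d t i) s').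
  have [ins params sites] := mem'; split => //= i iN.
  have [_ _ gi] := sites _ iN; split => //.
    by rewrite /overwrite insubT.
  by rewrite /overwrite insubT.
have [s'' [n [en len [mem3 ds3]]]] := update_runs u N2 T2 mem2 ds'.
exists s', m, n, s''; split => //; first by rewrite leq_add.
split; first by exists (extend c t), (extend d t).
by rewrite ds3 mulSn addnC.
Qed.

Lemma facility_algorithm_plays u : exists time : 'I_T -> nat,
  plays facility_algorithm C D c d u (fun t => selection u t) time /\
  forall t, (time t <= trial_cost)%N.
Proof.
pose good t s (r : state R * nat) := ready t s -> exists s' m n,
  [/\ exec u choose_com s s' m, selected N s' = selection u t,
      exec u update_com
        (reveal (fun i : 'I_N => extend c t i) (fun i : 'I_N => extend d t i) s')
        r.1 n, r.2 = (m + n)%N & (r.2 <= trial_cost)%N /\ ready t.+1 r.1].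
(* Since [exec] is a relation, a successor is chosen for every trial and state, with a dummy for
   states that are not [ready]; iterating it gives the run. *)
have /choice[f fP] : forall x : nat * state R, exists r, good x.1 x.2 r.
  move=> [t s].
  have [rs|nrs] := pselect (ready t s); last by exists (s, 0%N) => /nrs.
  have [s' [m [n [s'' [? ? ? ? ?]]]]] := trial_runs u rs.
  by exists (s'', (m + n)%N) => _; exists s', m, n; split.
pose st := fix st t := if t is t'.+1 then (f (t', st t')).1
                       else initial_state N T C D.
have readyS t : ready t (st t).
  elim: t => [|t IH].
    split => //; exists (fun=> 0), (fun=> 0).
    by split => // i; rewrite /=.
  by have [s' [m [n [_ _ _ _ [_ ?]]]]] := fP (t, st t) IH.
exists (fun t : 'I_T => (f (t : nat, st t)).2); split => [|t].
  exists st; split => // t.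
  have [s' [m [n [ec es eu et _]]]] := fP (t : nat, st t) (readyS t).
  by exists s', m, n; rewrite -(extendE c t) -(extendE d t).
by have [s' [m [n [_ _ _ _ []]]]] := fP (t : nat, st t) (readyS t).
Qed.

(** There are at most [1 + ln T / ln 2 <= 4 ln T] bisection steps, and [1 <= 2 ln N] supplies the
    factor [ln N]: the constant is [600 * 4 * 2], rounded up. *)
Lemma trial_cost_le :
  trial_cost%:R <= 5000 * N%:R * ln N%:R * ln T%:R :> R.
Proof.
have lnN : 2^-1 <= ln N%:R :> R by exact: ln_nat_ge_half.
have lnT : 2^-1 <= ln T%:R :> R by exact: ln_nat_ge_half.
have J1 : (1 <= num_steps T)%N by rewrite /num_steps up_log_gt0.
have JT : (num_steps T)%:R <= 4 * ln T%:R :> R.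
  have /andP[h _] := up_log_bounds (isT : 1 < 2)%N T2.
  have : (2 ^ (num_steps T).-1)%:R <= T%:R :> R by rewrite ler_nat ltnW.
  rewrite natrX -ler_ln ?posrE ?exprn_gt0 ?ltr0n// ?(ltnW T2)//.
  rewrite lnXn// => h2.
  have : (num_steps T).-1%:R * ln 2 <= ln T%:R :> R.
    by apply: le_trans h2; rewrite mulr_natl.
  have x0 : 0 <= (num_steps T).-1%:R :> R by [].
  have := ler_wpM2l x0 (ln2_ge_half R).
  have -> : (num_steps T)%:R = (num_steps T).-1%:R + 1 :> R.
    by rewrite natr1 prednK.
  by move: lnT; lra.
have : (trial_cost <= 600 * N * num_steps T)%N.
  rewrite /trial_cost /update_cost /bisect_cost; nia.
rewrite -(ler_nat R) => /le_trans; apply.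
rewrite !natrM -!mulrA.
have -> : 5000 * (N%:R * (ln N%:R * ln T%:R)) =
    N%:R * (5000 * (ln N%:R * ln T%:R)) :> R by ring.
rewrite mulrCA ler_pM2l ?ltr0n//.
have : 0 <= ln T%:R * (ln N%:R - 2^-1) :> R by rewrite mulr_ge0//; lra.
lra.
Qed.

End Playing.

(** * Expected loss of the algorithm *)

Section Expectation.
Variables (R : realType) (N T : nat) (C D : R).
Variables (c d : 'I_T -> 'I_N -> R).
Hypothesis N2 : (2 <= N)%N.
Hypothesis T2 : (2 <= T)%N.
Hypothesis C0 : 0 <= C.
Hypothesis D0 : 0 <= D.
Hypothesis c0C : forall t i, 0 <= c t i <= C.
Hypothesis d0D : forall t i, 0 <= d t i <= D.
Context {disp : measure_display} {Omega : measurableType disp}.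
Variables (P : probability Omega R) (U : nat -> {RV P >-> R}).
Hypothesis iidU : iid_uniform01 U.

Let i0 : 'I_N := Ordinal (ltnW N2).
Let W := C + D.
Let u w n := U n w.
Let ce := extend c.
Let de := extend d.
Let g := gain C D c d.
Let raw t w := raw_selection C D c d (u w) t.
Let X t w := selection C D c d N2 (u w) t.

Let q t (i : nat) : R := T%:R `^ (0 - site_weight N T C D (g t i)).

Let T0 : 0 < T%:R :> R. Proof. by rewrite ltr0n ltnW. Qed.
Let w0 t i : 0 <= site_weight N T C D (g t i). Proof. exact: weight_ge0. Qed.

Let q01 t i : 0 <= q t i <= 1.
Proof.
rewrite powR_ge0 /q -[X in _ <= X](powRr0 T%:R) ler_powR ?ler1n ?(ltnW T2)//.
by rewrite sub0r oppr_le0.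
Qed.

(** With few trials the selection is constantly empty; otherwise it is an independent inclusion read
    from tape entry [t * N] on. *)
Lemma measurable_raw_selection t S : measurable [set w | raw t w = S].
Proof.
have [few|many] := boolP (T%:R < 16 * approx_ln (N%:R : R)).
  rewrite (_ : [set w | _] = [set w | finset.set0 = S]); last first.
    apply/funext => w /=; congr (_ = S); apply/setP => i.
    by rewrite !inE /chosen few.
  have [S0|S0] := pselect (finset.set0 = S).
    rewrite (_ : [set w | _] = setT); first exact: measurableT.
    by apply/seteqP; split.
  rewrite (_ : [set w | _] = set0); first exact: measurable0.
  by apply/seteqP; split.
rewrite (_ : [set w | _] = [set w | included U N (t * N) (q t) w = S]).
  exact: measurable_included.
apply/funext => w /=; congr (_ = S); apply/setP => i.
by rewrite !inE /chosen many.
Qed.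

Lemma measurable_selection t S : measurable [set w | X t w = S].
Proof.
exact: (@measurable_finite_image _ _ _ (raw t) (measurable_raw_selection t)).
Qed.

Let expected_cost (t : nat) : R :=
  \sum_S law P (raw t) S *
    loss (fun i : 'I_N => ce t i) (fun i : 'I_N => de t i) (fallback i0 S).

Lemma expected_total_loss :
  ('E_P[fun w => (\sum_(t < T) loss (c t) (d t) (X t w))%R] =
   (\sum_(t < T) expected_cost t)%:E)%E.
Proof.
have l0 (t : 'I_T) S : 0 <= loss (c t) (d t) S.
  by apply: loss_ge0 => i; [have /andP[] := c0C t i|have /andP[] := d0D t i].
rewrite unlock; under eq_integral do rewrite -sumEFin.
rewrite ge0_integral_sum//; last 2 first.
- move=> t; apply: (measurable_finite_valued (measurable_raw_selection t)
    (fun S => loss (c t) (d t) (fallback i0 S))).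
- by move=> t w _; rewrite lee_fin.
rewrite -sumEFin; apply: eq_bigr => t _.
rewrite (@integral_finite_valued _ _ _ _ _ _ (measurable_raw_selection t)
  (fun S => loss (c t) (d t) (fallback i0 S)))//.
by rewrite /expected_cost /ce /de !extendE.
Qed.

Let ce0C t i : 0 <= ce t i <= C. Proof. exact: extend_bounds. Qed.
Let de0D t i : 0 <= de t i <= D. Proof. exact: extend_bounds. Qed.

Let law1 t : \sum_S law P (raw t) S = 1.
Proof.
apply: EFin_inj; have := @integral_finite_valued _ _ _ P _ _
  (measurable_raw_selection t) (fun=> 1) (fun=> ler01).
under [in RHS]eq_bigr do rewrite mulr1.
by move=> <-; rewrite integral_cst//= mul1e probability_setT.
Qed.

Let r t := (site_bisect N T C D (de t) (g t) (num_steps T)).1.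

Lemma expected_cost_le t : 16 * approx_ln (N%:R : R) <= T%:R ->
  expected_cost t <= ln T%:R * (\sum_(i < N) ce t i * site_weight N T C D (g t i))
  + (r t - \sum_(i < N) site_weight N T C D (g t i) *
                        gap (fun i : 'I_N => de t i) (r t) i)
  + 3 * W / T%:R.
Proof.
move=> many; have W0 : 0 <= W by rewrite addr_ge0.
have y0 (i : 'I_N) := w0 t i.
have d0 (i : 'I_N) : 0 <= de t i by have /andP[] := de0D t i.
have [b1 b2 b3 b4 b5] := bisect_spec W0 d0 y0 (num_steps T).
apply: (@expected_loss_le R N C D _ _ (fun i => ce0C t i) (fun i => de0D t i)
  i0 T (law P (raw t)) (fun i : 'I_N => site_weight N T C D (g t i)) T2
  _ _ _ _ _ (site_bisect N T C D (de t) (g t) (num_steps T)).2) => //.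
- by move=> S; exact: law_ge0.
- move=> S.
  have rawE : raw t = included U N (t * N) (q t).
    apply/funext => w; apply/setP => i.
    by rewrite !inE /chosen -leNgt many.
  rewrite rawE (law_included_miss iidU (t * N) (q01 t)).
  rewrite /q /powR gt_eqF// -sumrN mulr_suml expR_sum.
  by apply: eq_bigr => i _; rewrite sub0r.
- rewrite bisect_width ler_wpM2l// lef_pV2 ?posrE ?exprn_gt0//.
  rewrite -natrX ler_nat.
  by have /andP[] := up_log_bounds (isT : 1 < 2)%N T2.
Qed.

(** Three cases: few trials, where site 0 is played throughout; [C + D > 0], where the competitive
    bound applies; and [C = D = 0], where the learning rate is meaningless but every loss
    vanishes. *)
Lemma expected_total_loss_le S : S != finset.set0 ->
  ('E_P[fun w => (\sum_(t < T) loss (c t) (d t) (X t w))%R] <=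
    (48 * (ln T%:R * (\sum_(t < T) loss (c t) (d t) S)
      + #|S|%:R * (C + D) * ln T%:R * Num.sqrt (ln N%:R * T%:R)))%:E)%E.
Proof.
move=> S0.
have lnT : 0 <= ln T%:R :> R by rewrite ln_ge0// ler1n ltnW.
have O0 : 0 <= \sum_(t < T) loss (c t) (d t) S.
  apply: sumr_ge0 => t _.
  by apply: loss_ge0 => i; [have /andP[] := c0C t i|have /andP[] := d0D t i].
rewrite expected_total_loss lee_fin.
have [many|few] := leP (16 * approx_ln (N%:R : R)) T%:R; last first.
  apply: (@le_trans _ _ (W * T%:R)).
    rewrite mulr_natr -[X in _ *+ X]card_ord -sumr_const; apply: ler_sum => t _.
    rewrite -[W]mul1r -(law1 t) mulr_suml; apply: ler_sum => Y _.
    have [->|Y0] := eqVneq Y finset.set0.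
      rewrite ler_wpM2l ?law_ge0// /ce /de !extendE /fallback eqxx.
      exact: loss_set1_le.
    rewrite (_ : law _ _ _ = 0) ?mul0r// /law (_ : [set w | _] = set0).
      by rewrite measure0.
    apply/seteqP; split => // w /= rY; case/negP: Y0; apply/eqP.
    by rewrite -rY; apply/setP => i; rewrite !inE /chosen few.
  have k0 : (0 < #|S|)%N by rewrite card_gt0.
  have := few_trials_bound N2 T2 (addr_ge0 C0 D0) k0 few.
  have : 0 <= #|S|%:R * (C + D) * ln T%:R * Num.sqrt (ln N%:R * T%:R) :> R.
    by rewrite !mulr_ge0 ?addr_ge0 ?sqrtr_ge0.
  have := mulr_ge0 lnT O0; rewrite /W; lra.
have : 0 <= W by rewrite addr_ge0.
rewrite le_eqVlt => /predU1P[W0|W0]; last first.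
  have := @competitive_bound R N T C D N2 T2 W0 many (fun t i => ce t i)
    (fun t i => de t i) (fun t i => g t i) r expected_cost.
  have ceW t (i : 'I_N) : 0 <= ce t i <= W.
    by have /andP[-> h] := ce0C t i; rewrite (le_trans h)// lerDl.
  have de0 t (i : 'I_N) : 0 <= de t i by have /andP[] := de0D t i.
  have b t := bisect_spec (ltW W0) (de0 t) (fun i : 'I_N => w0 t i) (num_steps T).
  have rW t : 0 <= r t <= W.
    have [b1 b2 b3 _ _] := b t; rewrite b1 /=.
    by apply: le_trans b3; rewrite lerDl.
  have ry t := let: And5 _ _ _ h _ := b t in h.
  move=> /(_ ceW de0 (fun=> erefl) (fun t i => erefl) rW ry
    (fun t => expected_cost_le t many) S S0).
  rewrite (_ : \sum_(t < T) loss _ _ S = \sum_(t < T) loss (c t) (d t) S)//.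
  by apply: eq_bigr => t _; rewrite /ce /de !extendE.
have /eqP : C + D = 0 by exact: esym W0.
rewrite paddr_eq0// => /andP[/eqP C00 /eqP D00].
apply: (@le_trans _ _ 0); last first.
  by rewrite mulr_ge0// addr_ge0// !mulr_ge0 ?addr_ge0 ?sqrtr_ge0.
apply: sumr_le0 => t _; apply: sumr_le0 => Y _.
rewrite mulr_ge0_le0 ?law_ge0//.
have ce0 (i : 'I_N) : ce t i = 0.
  by have /andP[h1 h2] := ce0C t i; apply/eqP; rewrite eq_le h1 -[X in _ <= X]C00 h2.
rewrite /loss big1 ?add0r//; have /set0Pn[i iY] := fallback_neq0 i0 Y.
apply: le_trans (min_over_le _ iY) _.
by have /andP[_] := de0D t i; rewrite D00.
Qed.

End Expectation.

Theorem mainTheorem1 (R : realType) :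
  exists (kappa : R) (A : algorithm), 0 < kappa /\
  forall (N T : nat) (C D : R) (c d : 'I_T -> 'I_N -> R),
    (2 <= N)%N -> (2 <= T)%N -> 0 <= C -> 0 <= D ->
    (forall t i, 0 <= c t i <= C) ->
    (forall t i, 0 <= d t i <= D) ->
  forall (disp : measure_display) (Omega : measurableType disp)
    (P : probability Omega R) (U : nat -> {RV P >-> R}),
    iid_uniform01 U ->
  exists (X : 'I_T -> Omega -> {set 'I_N}) (time : 'I_T -> Omega -> nat),
    [/\ forall w, plays A C D c d (fun n => U n w) (X ^~ w) (time ^~ w),
        forall t w, X t w != finset.set0,
        forall t (S : {set 'I_N}), measurable [set w | X t w = S],
        forall Xstar : {set 'I_N}, Xstar != finset.set0 ->
          ('E_P[fun w => (\sum_(t < T) loss (c t) (d t) (X t w))%R] <=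
           (kappa * (ln T%:R * (\sum_(t < T) loss (c t) (d t) Xstar)
                     + #|Xstar|%:R * (C + D) * ln T%:R
                       * Num.sqrt (ln N%:R * T%:R)))%:E)%E
      & forall t w, (time t w)%:R <= kappa * N%:R * ln N%:R * ln T%:R].
Proof.
(* The time bound dictates this constant; the loss bound holds with 48. *)
exists 5000, facility_algorithm; split; first by rewrite ltr0n.
move=> N T C D c d N2 T2 C0 D0 c0C d0D disp Omega P U iidU.
have /choice[time timeP] : forall w, exists time : 'I_T -> nat,
    plays facility_algorithm C D c d (fun n => U n w)
      (fun t => selection C D c d N2 (fun n => U n w) t) time /\
    forall t, (time t <= trial_cost N T)%N.
  by move=> w; exact: facility_algorithm_plays.
exists (fun t w => selection C D c d N2 (fun n => U n w) t), (fun t w => time w t).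
split.
- by move=> w; have [] := timeP w.
- by move=> t w; exact: fallback_neq0.
- by move=> t S; exact: measurable_selection.
- move=> S S0.
  apply: le_trans (expected_total_loss_le N2 T2 C0 D0 c0C d0D iidU S0) _.
  rewrite lee_fin ler_wpM2r ?ler_nat//.
  have lnT : 0 <= ln T%:R :> R by rewrite ln_ge0// ler1n ltnW.
  rewrite addr_ge0// ?mulr_ge0 ?addr_ge0 ?sqrtr_ge0//.
  by apply: sumr_ge0 => t _; apply: loss_ge0 => i;
    [have /andP[] := c0C t i|have /andP[] := d0D t i].
- move=> t w; apply: le_trans (trial_cost_le R N2 T2).
  by rewrite ler_nat; have [_] := timeP w.
Qed.
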